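(* Let $0<\mu<\overline{v}$ and consider the setting with exactly two bidders. Let $\underline{v}$ be the unique solution in $(0,\overline{v}]$ of $\underline{v}\left(1+\log\overline{v}-\log\underline{v}\right)=\mu$. Define the CDFs $$F^*(v)=\begin{cases}0 & v\in[0,\underline{v}],\\ 1-\underline{v}/v & v\in[\underline{v},\overline{v}),\\ 1 & v\ge\overline{v},\end{cases}$$ $$Q^*(r)=\begin{cases}\left(1-\frac{\underline{v}}{\overline{v}}\right)\cdot\frac{1}{\log\overline{v}-\log\underline{v}} & r\in[0,\underline{v}],\\[4pt] \left(1-\frac{\underline{v}}{\overline{v}}\right)\cdot\frac{r}{r-\underline{v}}\cdot\frac{\log r-\log\underline{v}}{\log\overline{v}-\log\underline{v}} & r\in(\underline{v},\overline{v}],\end{cases}$$ and let $M^*$ be the second-price auction with randomized reserve price sampled from $Q^*$. Then $(M^*,F^* )$ is an equilibrium of the general zero-sum game, i.e. $M^*\in\mathcal{M}$, $F^*\in\mathcal{F}$ and $$\mathrm{Rev}_{F^*}(M)\le\mathrm{Rev}_{F^*}(M^* )\le\mathrm{Rev}_{F}(M^* )\qquad\text{for all }M\in\mathcal{M},\ F\in\mathcal{F};$$ in particular $$M^*\in\operatorname*{argmax}_{M\in\mathcal{M}}\min_{F\in\mathcal{F}}\mathrm{Rev}_F(M),\qquad F^*\in\operatorname*{argmin}_{F\in\mathcal{F}}\max_{M\in\mathcal{M}}\mathrm{Rev}_F(M).$$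
   Context: A seller offers one item to two bidders whose values $v_1,v_2$ are i.i.d. from a distribution $F$. Distributions are identified with their CDFs (equal to $0$ on $(-\infty,0)$ and $1$ on $[\overline{v},\infty)$ when supported in $[0,\overline{v}]$); $\log$ is the natural logarithm. $\mathcal{F}=\mathcal{F}(\mu,\overline{v})$ is the set of all probability distributions with expectation $\mu$ and support contained in $[0,\overline{v}]$. A (direct, possibly randomized) mechanism $M$ consists of an allocation rule $x=(x_1,x_2)$ and a payment rule $p=(p_1,p_2)$, measurable functions of the bid profile $\vec b=(b_1,b_2)$, where $x_i(\vec b)\in[0,1]$ is the probability that bidder $i$ gets the item ($x_1+x_2\le1$) and $p_i(\vec b)\in\mathbb{R}$ is bidder $i$'s expected payment (over the internal randomness of the mechanism). Bidder $i$ with value $v_i$ has expected utility $v_i x_i(\vec b)-p_i(\vec b)$. The mechanism is truthful if it is dominant-strategy incentive compatible and individually rational: for every bidder $i$, every value $v_i$, every bid $b_i'$ and every bid $b_{-i}$ of the other bidder, $v_i x_i(v_i,b_{-i})-p_i(v_i,b_{-i})\ge v_i x_i(b_i',b_{-i})-p_i(b_i',b_{-i})$ and $v_i x_i(v_i,b_{-i})-p_i(v_i,b_{-i})\ge 0$. $\mathcal{M}$ is the set of all truthful mechanisms, and $$\mathrm{Rev}_F(M)=\mathbb{E}_{v_1,v_2\sim_{\text{i.i.d.}}F}\Big[\sum_i p_i(v_1,v_2)\Big].$$ The second-price auction with reserve $r$ sells the item to a highest bidder (ties broken arbitrarily) if and only if the highest bid is strictly greater than $r$, and the winner then pays the maximum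 of $r$ and the other bid; with randomized reserve from $Q$, $r$ is drawn from $Q$ independently of the bids. In the general zero-sum game the seller chooses $M\in\mathcal{M}$, the adversary chooses $F\in\mathcal{F}$, and the payoff $\mathrm{Rev}_F(M)$ is maximized by the seller and minimized by the adversary. *)

(* Defs.v *)
From HB Require Import structures.
From mathcomp Require Import all_boot all_order all_algebra.
From mathcomp Require Import all_classical all_reals all_analysis.

Set Implicit Arguments.
Unset Strict Implicit.
Unset Printing Implicit Defensive.

Import Order.TTheory GRing.Theory Num.Theory.
Import numFieldNormedType.Exports.

Local Open Scope classical_set_scope.
Local Open Scope ring_scope.

(* [R] with its Borel sigma-algebra; [cdf] and [lebesgue_stieltjes_measure]
   are stated on this carrier. *)
Notation borel R := (measurableTypeR R).

Definition value_of (R : realType) : borel R -> R := idfun.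

HB.instance Definition _ (R : realType) :=
  @isMeasurableFun.Build _ _ _ _ (@value_of R) (@measurable_id _ _ setT).

Definition has_cdf (R : realType) (P : probability (borel R) R) (G : R -> R) :=
  forall r : R, cdf (@value_of R : {RV P >-> R}) r = (G r)%:E.

Definition ambiguity_set (R : realType) (mu vbar : R) :
    set (probability (borel R) R) :=
  [set F : probability (borel R) R |
    F `[0, vbar]%classic = 1%E /\ ('E_F[@value_of R] = mu%:E)%E].

(* A bid profile is a pair: [b.1] is the bid of bidder [ord0], [b.2] that of
   the other bidder. *)
Record mechanism (R : realType) := Mechanism {
  alloc : 'I_2 -> R * R -> R ;
  pay : 'I_2 -> R * R -> R }.

Definition profile (R : realType) (i : 'I_2) (own other : R) : R * R :=
  if i == ord0 then (own, other) else (other, own).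

Definition own_bid (R : realType) (i : 'I_2) (b : R * R) : R :=
  if i == ord0 then b.1 else b.2.

Definition other_bid (R : realType) (i : 'I_2) (b : R * R) : R :=
  if i == ord0 then b.2 else b.1.

Definition utility (R : realType) (M : mechanism R) (i : 'I_2) (v : R)
    (b : R * R) : R :=
  v * alloc M i b - pay M i b.

(* Values and bids range over the nonnegative reals; what a mechanism does on
   profiles with a negative bid is irrelevant, apart from measurability. *)
Record truthful (R : realType) (M : mechanism R) : Prop := Truthful {
  measurable_alloc : forall i : 'I_2,
    measurable_fun [set: borel R * borel R] (alloc M i) ;
  measurable_pay : forall i : 'I_2,
    measurable_fun [set: borel R * borel R] (pay M i) ;
  alloc_itv : forall (i : 'I_2) (b : R * R), 0 <= b.1 -> 0 <= b.2 ->
    0 <= alloc M i b <= 1 ;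
  alloc_sum : forall b : R * R, 0 <= b.1 -> 0 <= b.2 ->
    \sum_(i < 2) alloc M i b <= 1 ;
  incentive_compatible : forall (i : 'I_2) (v b' c : R),
    0 <= v -> 0 <= b' -> 0 <= c ->
    utility M i v (profile i b' c) <= utility M i v (profile i v c) ;
  individually_rational : forall (i : 'I_2) (v c : R), 0 <= v -> 0 <= c ->
    0 <= utility M i v (profile i v c) }.

Definition truthful_mechanisms (R : realType) : set (mechanism R) :=
  [set M : mechanism R | truthful M].

(* Individual rationality bounds payments by values, so for a truthful
   mechanism and a bounded-support [F] the positive part is integrable and the
   expectation is well defined in [-oo, +oo[; it is [-oo] when the negative
   part is not integrable. *)
Definition Rev (R : realType) (F : probability (borel R) R) (M : mechanism R) :
    \bar R :=
  ('E_(F \x F)[fun b => (\sum_(i < 2) pay M i b)%R])%E.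

(* [tie (r, c)] is the probability that bidder [ord0] wins when both bids are
   equal to [c] and the realized reserve is [r]. *)
Definition tie_share (R : realType) (tie : R * R -> R) (i : 'I_2) (r c : R) :
    R :=
  if i == ord0 then tie (r, c) else 1 - tie (r, c).

Definition tie_rule (R : realType) (tie : R * R -> R) : Prop :=
  measurable_fun [set: borel R * borel R] tie /\
  forall rc : R * R, 0 <= tie rc <= 1.

Definition spa_alloc (R : realType) (tie : R * R -> R) (r : R) (i : 'I_2)
    (b : R * R) : R :=
  if r < Num.max b.1 b.2 then
    if other_bid i b < own_bid i b then 1
    else if own_bid i b == other_bid i b then tie_share tie i r (own_bid i b)
    else 0
  else 0.

Definition spa_pay (R : realType) (tie : R * R -> R) (r : R) (i : 'I_2)
    (b : R * R) : R :=
  Num.max r (other_bid i b) * spa_alloc tie r i b.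

Definition spa_random_reserve (R : realType) (Q : probability (borel R) R)
    (tie : R * R -> R) : mechanism R :=
  Mechanism (fun i b => \int[Q]_r spa_alloc tie r i b)
            (fun i b => \int[Q]_r spa_pay tie r i b).

Definition is_equilibrium (R : realType) (mu vbar : R) (M : mechanism R)
    (F : probability (borel R) R) : Prop :=
  [/\ truthful_mechanisms M,
      ambiguity_set mu vbar F,
      forall M' : mechanism R, truthful_mechanisms M' ->
        (Rev F M' <= Rev F M)%E &
      forall F' : probability (borel R) R, ambiguity_set mu vbar F' ->
        (Rev F M <= Rev F' M)%E].

Definition argmax (R : realType) (T : Type) (A : set T) (f : T -> \bar R) :
    set T :=
  [set x : T | A x /\ forall y : T, A y -> (f y <= f x)%E].

Definition argmin (R : realType) (T : Type) (A : set T) (f : T -> \bar R) :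
    set T :=
  [set x : T | A x /\ forall y : T, A y -> (f x <= f y)%E].

(* For a general mechanism (resp. distribution) the minimum (resp. maximum)
   need not be attained, hence the infimum (resp. supremum). *)
Definition worst_case_rev (R : realType) (mu vbar : R) (M : mechanism R) :
    \bar R :=
  ereal_inf [set Rev F M | F in ambiguity_set mu vbar].

Definition best_rev (R : realType) (F : probability (borel R) R) : \bar R :=
  ereal_sup [set Rev F M | M in @truthful_mechanisms R].

Definition Fstar_cdf (R : realType) (vlow vbar v : R) : R :=
  if v <= vlow then 0
  else if v < vbar then 1 - vlow / v
  else 1.

Definition Qstar_cdf (R : realType) (vlow vbar r : R) : R :=
  if r < 0 then 0
  else if r <= vlow then (1 - vlow / vbar) * (ln vbar - ln vlow)^-1
  else if r <= vbar then
    (1 - vlow / vbar) * (r / (r - vlow)) *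
      ((ln r - ln vlow) / (ln vbar - ln vlow))
  else 1.

Definition is_vlow (R : realType) (mu vbar vlow : R) : Prop :=
  0 < vlow <= vbar /\ vlow * (1 + ln vbar - ln vlow) = mu.

(* Main.v *)
(** Write [a] for [vlow], [b] for [vbar], [K v w] for the expected total payment
    of [M*] at the bids [v, w], and [B P P'] for the integral of [K] with respect
    to the product of [P] and [P'], so that [Rev P M* = B P P].

    Lower bound.  Integrating over the reserve gives
    [K v w = Phi v + Phi w + g (max v w)] with [Phi x] the integral of [Q*] over
    [[0, x]] and [g x = x * Q* x - 2 * Phi x].  Since [Q* x / x] is nonincreasing,
    so is [g], hence [g (max v w) = min (g v) (g w)]; the kernel [min] is positive
    semidefinite, so [B P P >= 2 * B P F* - B F* F*].  The choice of [Q*] makes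
    [v |-> B (delta v) F*] affine, equal to [a + C (v - a)] with [C] the atom of
    [Q*] at [0]: this comes from [F* s * Q* s = C (ln s - ln a)] for
    [a <= s < b].  Thus [B P F*] depends on [P] only through its mean, and
    [Rev P M* >= Rev F* M* = a (2 - a / b)] whenever [P] has mean [mu].

    Upper bound.  Against a fixed opposing bid a truthful mechanism is a mixture
    of posted prices, each of which earns at most [a] from the equal-revenue
    distribution [F*]; so the expected payment of a bidder is at most [a] times its
    allocation at the value [b].  When the opposing bid is [b] as well, which has
    probability [a / b], the two allocations sum to at most [1]; the total is
    therefore at most [a (2 - a / b)] again. *)

Require Import Defs.
From HB Require Import structures.
From mathcomp Require Import all_boot all_order all_algebra.
From mathcomp Require Import all_classical all_reals all_analysis.
From mathcomp Require Import measurable_realfun ring lra.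

Set Implicit Arguments.
Unset Strict Implicit.
Unset Printing Implicit Defensive.

Import Order.TTheory GRing.Theory Num.Theory.
Import numFieldNormedType.Exports.

Local Open Scope classical_set_scope.
Local Open Scope ring_scope.

(** * Bounded measurable functions *)

(** Under a probability measure these two conditions give integrability, so the side conditions of
    linearity, monotonicity and Fubini reduce to one predicate that is closed under the operations
    below. *)
Definition bounded_mfun d (T : measurableType d) (R : realType) (f : T -> R) :=
  measurable_fun [set: T] f /\ exists k : R, forall x, `|f x| <= k.

Section bounded_mfun_closure.
Context d (T : measurableType d) (R : realType).
Implicit Types f g : T -> R.

Lemma bounded_mfun_cst (k : R) : bounded_mfun (fun _ : T => k).
Proof. by split; [exact: measurable_cst | exists `|k|]. Qed.

Lemma bounded_mfunD f g : bounded_mfun f -> bounded_mfun g ->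
  bounded_mfun (fun x => f x + g x).
Proof.
move=> [mf [k hk]] [mg [l hl]]; split; first exact: measurable_funD.
by exists (k + l) => x; rewrite (le_trans (ler_normD _ _))// lerD.
Qed.

Lemma bounded_mfunM f g : bounded_mfun f -> bounded_mfun g ->
  bounded_mfun (fun x => f x * g x).
Proof.
move=> [mf [k hk]] [mg [l hl]]; split; first exact: measurable_funM.
by exists (k * l) => x; rewrite normrM ler_pM.
Qed.

Lemma bounded_mfunN f : bounded_mfun f -> bounded_mfun (fun x => - f x).
Proof.
move=> [mf [k hk]]; split; first exact: measurableT_comp.
by exists k => x; rewrite normrN.
Qed.

Lemma bounded_mfunB f g : bounded_mfun f -> bounded_mfun g ->
  bounded_mfun (fun x => f x - g x).
Proof. by move=> bf bg; apply: bounded_mfunD => //; exact: bounded_mfunN. Qed.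

Lemma bounded_mfun_nat (b : T -> bool) : measurable_fun [set: T] b ->
  bounded_mfun (fun x => (b x)%:R : R).
Proof.
move=> mb; split; last by exists 1 => x; case: (b x); rewrite ?normr1 ?normr0.
rewrite (_ : (fun x => _) = (fun x => if b x then 1 else 0 : R)).
  exact: measurable_fun_ifT.
by apply/funext => x; case: (b x).
Qed.

Lemma bounded_mfun_if (b : T -> bool) f g : measurable_fun [set: T] b ->
  bounded_mfun f -> bounded_mfun g ->
  bounded_mfun (fun x => if b x then f x else g x).
Proof.
move=> mb [mf [k hk]] [mg [l hl]]; split; first exact: measurable_fun_ifT.
exists (Num.max k l) => x; case: (b x); rewrite le_max.
- by rewrite hk.
- by rewrite hl orbT.
Qed.

Lemma bounded_mfun_min f g : bounded_mfun f -> bounded_mfun g ->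
  bounded_mfun (fun x => Num.min (f x) (g x)).
Proof.
move=> bf bg; have -> : (fun x => Num.min (f x) (g x)) =
    (fun x => if f x < g x then f x else g x) by [].
by apply: bounded_mfun_if => //; apply: measurable_fun_ltr; [apply bf|apply bg].
Qed.

End bounded_mfun_closure.

Lemma bounded_mfun_comp d d' (T : measurableType d) (T' : measurableType d')
    (R : realType) (f : T -> R) (h : T' -> T) :
  measurable_fun [set: T'] h -> bounded_mfun f ->
  bounded_mfun (fun x => f (h x)).
Proof. by move=> mh [mf [k hk]]; split; [exact: measurableT_comp|exists k]. Qed.

Section bounded_mfun_integral.
Context d (T : measurableType d) (R : realType) (P : probability T R).
Implicit Types f g : T -> R.

Lemma bounded_mfun_integrable f : bounded_mfun f ->
  P.-integrable [set: T] (EFin \o f).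
Proof.
move=> [mf [k hk]]; apply: measurable_bounded_integrable => //.
  by rewrite (le_lt_trans (probability_le1 _ _))// ltry.
exists k; split; first exact: num_real.
by move=> l kl x _; exact: (le_trans (hk x) (ltW kl)).
Qed.

Lemma Rintegral_EFin f : bounded_mfun f ->
  (\int[P]_x (f x)%:E = (\int[P]_x f x)%:E)%E.
Proof.
move=> bf; rewrite /Rintegral fineK//.
by apply: integrable_fin_num => //; exact: bounded_mfun_integrable.
Qed.

Lemma prob_Rintegral_cst (k : R) : \int[P]_x k = k.
Proof.
by rewrite Rintegral_cst//= probability_setT mulr1.
Qed.

Lemma bRintegralD f g : bounded_mfun f -> bounded_mfun g ->
  \int[P]_x (f x + g x) = \int[P]_x f x + \int[P]_x g x.
Proof. by move=> bf bg; apply: RintegralD => //; exact: bounded_mfun_integrable. Qed.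

Lemma bRintegralB f g : bounded_mfun f -> bounded_mfun g ->
  \int[P]_x (f x - g x) = \int[P]_x f x - \int[P]_x g x.
Proof. by move=> bf bg; apply: RintegralB => //; exact: bounded_mfun_integrable. Qed.

Lemma bRintegralZ f (k : R) : bounded_mfun f ->
  \int[P]_x (k * f x) = k * \int[P]_x f x.
Proof. by move=> bf; apply: RintegralZl => //; exact: bounded_mfun_integrable. Qed.

Lemma le_bRintegral f g : bounded_mfun f -> bounded_mfun g ->
  (forall x, f x <= g x) -> \int[P]_x f x <= \int[P]_x g x.
Proof.
by move=> bf bg fg; apply: le_Rintegral => //; exact: bounded_mfun_integrable.
Qed.

Lemma Rintegral_nat (A : set T) (b : T -> bool) :
  measurable A -> (forall x, b x <-> A x) ->
  \int[P]_x (b x)%:R = fine (P A).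
Proof.
move=> mA bA; rewrite -[A]setIT -integral_indic// /Rintegral; congr fine.
apply: eq_integral => x _; rewrite indicE; congr ((nat_of_bool _)%:R%:E).
by apply/idP/idP; rewrite inE => /bA.
Qed.

(** Serves to exchange an integrand that may be unbounded off the support for a bounded one that
    agrees with it on a set of full measure. *)
Lemma eq_integral_prob1 (A : set T) (f g : T -> \bar R) :
  measurable A -> P A = 1%E ->
  measurable_fun [set: T] f -> measurable_fun [set: T] g ->
  (forall x, A x -> f x = g x) -> (\int[P]_x f x = \int[P]_x g x)%E.
Proof.
move=> mA PA mf mg fg; apply: ae_eq_integral => //.
exists (~` A); split; first exact: measurableC.
- by rewrite /= probability_setC// PA subee.
- by move=> x /= nfg Ax; apply: nfg => _; exact: fg.
Qed.

Lemma eq_Rintegral_prob1 (A : set T) f g :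
  measurable A -> P A = 1%E ->
  measurable_fun [set: T] f -> measurable_fun [set: T] g ->
  (forall x, A x -> f x = g x) -> \int[P]_x f x = \int[P]_x g x.
Proof.
move=> mA PA mf mg fg; congr fine; apply: (eq_integral_prob1 mA PA).
- exact/measurable_EFinP.
- exact/measurable_EFinP.
- by move=> x Ax; rewrite fg.
Qed.

End bounded_mfun_integral.

Lemma measurable_Rintegral d1 d2 (T1 : measurableType d1)
    (T2 : measurableType d2) (R : realType) (P : probability T2 R)
    (f : T1 * T2 -> R) :
  measurable_fun [set: T1 * T2] f ->
  measurable_fun [set: T1] (fun x => \int[P]_y f (x, y)).
Proof.
move=> mf; apply: measurableT_comp => //.
rewrite (_ : (fun x => _) = (fun x =>
    \int[P]_y ((EFin \o f)^\+ (x, y)) - \int[P]_y ((EFin \o f)^\- (x, y)))%E).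
  have mEf : measurable_fun [set: T1 * T2] (EFin \o f) by exact/measurable_EFinP.
  apply: emeasurable_funB.
  - apply: (@measurable_fun_fubini_tonelli_F _ _ _ _ _ P ((EFin \o f)^\+)%E) => //.
    exact: measurable_funepos.
  - apply: (@measurable_fun_fubini_tonelli_F _ _ _ _ _ P ((EFin \o f)^\-)%E) => //.
    exact: measurable_funeneg.
by apply/funext => x; rewrite [LHS]integralE; congr (_ - _)%E;
  apply: eq_integral => y _; rewrite ?funeposE ?funenegE.
Qed.

Section bounded_mfun_fubini.
Context d1 d2 (T1 : measurableType d1) (T2 : measurableType d2) (R : realType).
Variables (P1 : probability T1 R) (P2 : probability T2 R).
Implicit Type f : T1 * T2 -> R.

Lemma bounded_mfun_Rintegral f : bounded_mfun f ->
  bounded_mfun (fun x => \int[P2]_y f (x, y)).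
Proof.
move=> [mf [k hk]]; split; first exact: measurable_Rintegral.
exists k => x.
have bf : bounded_mfun (fun y => f (x, y)).
  by split; [exact: measurableT_comp mf _|exists k].
apply: (le_trans (le_normr_Rintegral _ _)) => //.
  exact: bounded_mfun_integrable.
rewrite -[leRHS](prob_Rintegral_cst P2); apply: le_bRintegral => //.
- by split; [exact: measurableT_comp (proj1 bf)|exists k => y; rewrite normr_id].
- exact: bounded_mfun_cst.
Qed.

Lemma bounded_Fubini f : bounded_mfun f ->
  \int[P1]_x \int[P2]_y f (x, y) = \int[P2]_y \int[P1]_x f (x, y).
Proof.
move=> bf; have imf := bounded_mfun_integrable (P1 \x P2)%E bf.
have := Fubini imf.
have E1 x : (\int[P2]_y (EFin \o f) (x, y) = (\int[P2]_y f (x, y))%:E)%E.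
  by apply: Rintegral_EFin; apply: bounded_mfun_comp bf.
have E2 y : (\int[P1]_x (EFin \o f) (x, y) = (\int[P1]_x f (x, y))%:E)%E.
  by apply: Rintegral_EFin; apply: bounded_mfun_comp bf.
under eq_integral do rewrite E1; under [X in _ = X]eq_integral do rewrite E2.
by move=> E; exact: (congr1 fine E).
Qed.

Lemma bounded_Rintegral_prod f : bounded_mfun f ->
  (\int[P1 \x P2]_z (f z)%:E = (\int[P1]_x \int[P2]_y f (x, y))%:E)%E.
Proof.
move=> bf; have imf := bounded_mfun_integrable (P1 \x P2)%E bf.
rewrite -(integral12_prod_meas1 imf) -Rintegral_EFin.
  apply: eq_integral => x _; rewrite -Rintegral_EFin//.
  exact: bounded_mfun_comp bf.
exact: bounded_mfun_Rintegral.
Qed.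

End bounded_mfun_fubini.

(** * Logarithms, [vlow] and distributions with a given CDF *)

Lemma ln_sub_le (R : realType) (x y : R) : 0 < x -> 0 < y ->
  ln y - ln x <= (y - x) / x.
Proof.
move=> x0 y0; rewrite -ln_div ?posrE//.
have -> : y / x = 1 + (y - x) / x by field; rewrite gt_eqF.
apply: le_ln1Dx; rewrite -subr_gt0 opprK.
have -> : (y - x) / x + 1 = y / x by field; rewrite gt_eqF.
exact: divr_gt0.
Qed.

Lemma ln_sub_ge (R : realType) (x y : R) : 0 < x -> 0 < y ->
  (y - x) / y <= ln y - ln x.
Proof.
move=> x0 y0; have := ln_sub_le y0 x0.
by rewrite -[X in X <= _]opprB lerNl -mulNr opprB.
Qed.

Lemma ln_sub_lt (R : realType) (x y : R) : 0 < x -> 0 < y -> x != y ->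
  ln y - ln x < (y - x) / x.
Proof.
move=> x0 y0 xy; rewrite -ltr_expR -ln_div ?posrE// lnK ?posrE ?divr_gt0//.
have -> : y / x = 1 + (y - x) / x by field; rewrite gt_eqF.
apply: expR_gt1Dx; rewrite mulf_neq0//; first by rewrite subr_eq0 eq_sym.
by rewrite invr_neq0// gt_eqF.
Qed.

Section vlow.
Variables (R : realType) (mu vbar : R).
Hypotheses (mu_gt0 : 0 < mu) (mu_lt_vbar : mu < vbar).

Let phi (v : R) := v * (1 + ln vbar - ln v).

(** Since [x (ln y - ln x) < y - x], the difference [phi y - phi x] exceeds
    [(y - x) (ln vbar - ln y)], which is nonnegative. *)
Lemma vlow_mean_increasing (x y : R) : 0 < x -> x < y -> y <= vbar ->
  phi x < phi y.
Proof.
move=> x0 xy yb; have y0 := lt_trans x0 xy.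
have /(ln_sub_lt x0 y0) : x != y by rewrite lt_eqF.
rewrite ltr_pdivlMr// => h.
have : ln y <= ln vbar by rewrite ler_ln ?posrE// (lt_le_trans y0).
rewrite /phi; nra.
Qed.

Lemma exists_vlow : exists! vlow, is_vlow mu vbar vlow.
Proof.
have b0 : 0 < vbar by exact: lt_trans mu_lt_vbar.
pose m := mu / vbar.
have m0 : 0 < m by exact: divr_gt0.
have m1 : m < 1 by rewrite ltr_pdivrMr// mul1r.
pose s := m / 2.
have s0 : 0 < s by rewrite divr_gt0.
(* Left endpoint for the intermediate value theorem: [phi x0 = vbar s^2 (1 - 2 ln s)], and
   [- s ln s <= 1 - s] bounds it by [vbar (2 s - s^2) <= vbar m = mu]. *)
pose x0 := vbar * (s * s).
have ss0 : 0 < s * s by exact: mulr_gt0.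
have x00 : 0 < x0 by exact: mulr_gt0.
have x0b : x0 <= vbar by rewrite /x0 ger_pMr// /s; nra.
have lnx0 : ln x0 = ln vbar + ln s + ln s.
  by rewrite /x0 lnM ?posrE// lnM ?posrE// addrA.
have px0 : phi x0 <= mu.
  have := @ln_sub_le R s 1 s0 ltr01; rewrite ln1 sub0r ler_pdivlMr// => h.
  rewrite /phi lnx0 /x0 (_ : mu = vbar * m); last by rewrite /m mulrC divfK ?gt_eqF.
  rewrite -mulrA ler_pM2l// (_ : m = s *+ 2); last by rewrite -mulr_natr divfK.
  nra.
have pb : phi vbar = vbar by rewrite /phi addrK mulr1.
have cphi : {within `[x0, vbar], continuous phi}.
  apply: continuous_in_subspaceT => x; rewrite inE/= in_itv/= => /andP[xx0 _].
  have x_gt0 : 0 < x by exact: lt_le_trans xx0.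
  apply: cvgM; first exact: cvg_id.
  apply: cvgB; first exact: cvg_cst.
  exact: continuous_ln.
have [|c] := @IVT R phi x0 vbar mu x0b cphi.
  by rewrite pb ge_min px0/= le_max (ltW mu_lt_vbar) orbT.
rewrite in_itv/= => /andP[x0c cb] pc.
have c0 : 0 < c by exact: lt_le_trans x0c.
exists c; split; first by split; [rewrite c0 cb|].
move=> y [/andP[y0 yb] py]; apply/eqP; case: (ltgtP c y) => // h.
- by have := vlow_mean_increasing c0 h yb; rewrite pc /phi py ltxx.
- by have := vlow_mean_increasing y0 h cb; rewrite pc /phi py ltxx.
Qed.

Lemma is_vlow_lt_vbar vlow : is_vlow mu vbar vlow -> 0 < vlow < vbar.
Proof.
move=> [/andP[v0 vb] e]; rewrite v0/= lt_neqAle vb andbT.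
apply/eqP => vE; move: e; rewrite vE addrK mulr1 => e.
by move: mu_lt_vbar; rewrite e ltxx.
Qed.

End vlow.

(** * Probability measures with a prescribed CDF *)

Section probability_of_cdf.
Variables (R : realType) (f : R -> R) (lo hi : R).
Hypotheses (f_nd : nondecreasing f)
  (f_lo : forall x, x < lo -> f x = 0) (f_hi : forall x, hi <= x -> f x = 1)
  (f_lip : forall x, exists k d, [/\ 0 < d, 0 < k &
     forall y, x < y -> y < x + d -> f y <= f x + k * (y - x)]).

(** [f_lip] bounds increments to the right of a point only, so it gives right continuity and still
    allows a jump at the point itself, as [F*] has at [b] and [Q*] at [0]. *)
Let f_rc : right_continuous f.
Proof.
move=> x; have [k [d [d0 k0 fk]]] := f_lip x.
apply/cvgrPdist_le => /= e e0; near=> y.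
have xy : x < y by near: y; exact: nbhs_right_gt.
rewrite ler0_norm; last by rewrite subr_le0; apply: f_nd; exact: ltW.
rewrite opprB lerBlDl.
apply: (le_trans (fk y xy _)).
- by near: y; apply: nbhs_right_lt; rewrite ltrDl.
- rewrite lerD2l mulrC -ler_pdivlMr// lerBlDl ltW//.
  by near: y; apply: nbhs_right_lt; rewrite ltrDl divr_gt0.
Unshelve. all: by end_near. Qed.

HB.instance Definition _ := isCumulative.Build R _ R f f_nd f_rc.

Let f_Ny : f x @[x --> -oo] --> (0 : R).
Proof.
apply: cvg_near_cst; near=> x; apply: f_lo.
by near: x; apply: nbhs_ninfty_lt; exact: num_real.
Unshelve. all: by end_near. Qed.

Let f_y : f x @[x --> +oo] --> (1 : R).
Proof.
apply: cvg_near_cst; near=> x; apply: f_hi.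
by near: x; apply: nbhs_pinfty_ge; exact: num_real.
Unshelve. all: by end_near. Qed.

HB.instance Definition _ := isCumulativeBounded.Build R 0 1 f f_Ny f_y.

Lemma exists_probability_cdf : exists P : probability (borel R) R, has_cdf P f.
Proof.
exists (lebesgue_stieltjes_measure f) => r.
exact: cdf_lebesgue_stieltjes_id.
Qed.

End probability_of_cdf.

(** * The functions [F*] and [Q*] *)

Section log_slopes.
Variables (R : realType) (a s t : R).
Hypotheses (a_gt0 : 0 < a) (as_ : a < s) (st : s <= t).

Let s_gt0 : 0 < s. Proof. exact: lt_trans as_. Qed.
Let t_gt0 : 0 < t. Proof. exact: lt_le_trans st. Qed.

(** Chords of the concave [ln] issued from [a] get flatter: [(ln r - ln a) / (r - a)] is
    nonincreasing, and on []a, b]] it equals [Q* r / r] up to the factor [C]. *)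
Lemma ln_slope_decreasing : (ln t - ln a) * (s - a) <= (ln s - ln a) * (t - a).
Proof.
have := ln_sub_le s_gt0 t_gt0; rewrite ler_pdivlMr// => h1.
have := ln_sub_ge a_gt0 s_gt0; rewrite ler_pdivrMr// => h2.
have -> : ln t - ln a = (ln t - ln s) + (ln s - ln a) by ring.
set D := ln t - ln s in h1 *; set L := ln s - ln a in h2 *.
rewrite -(ler_pM2l s_gt0).
have k1 : D * s * (s - a) <= (t - s) * (s - a) by rewrite ler_wpM2r// subr_ge0 ltW.
have k2 : (s - a) * (t - s) <= L * s * (t - s) by rewrite ler_wpM2r// subr_ge0.
lra.
Qed.

(** Divided through, [r (ln r - ln a) / (r - a)] is nondecreasing; on []a, b]] it is [Q* r] up to
    the factor [C]. Again [ln t - ln a] is split at [s] and each half is estimated by a tangent. *)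
Lemma ln_weighted_slope_increasing :
  s * (ln s - ln a) * (t - a) <= t * (ln t - ln a) * (s - a).
Proof.
have := ln_sub_ge s_gt0 t_gt0; rewrite ler_pdivrMr// => h1.
have := ln_sub_le a_gt0 s_gt0; rewrite ler_pdivlMr// => h2.
have -> : ln t - ln a = (ln t - ln s) + (ln s - ln a) by ring.
set D := ln t - ln s in h1 *; set L := ln s - ln a in h2 *.
have k1 : (t - s) * (s - a) <= D * t * (s - a) by rewrite ler_wpM2r// subr_ge0 ltW.
have k2 : L * a * (t - s) <= (s - a) * (t - s) by rewrite ler_wpM2r// subr_ge0.
lra.
Qed.

End log_slopes.

Section Fstar.
Variables (R : realType) (a b : R).
Hypotheses (a_gt0 : 0 < a) (ab : a < b).
Local Notation Fc := (Fstar_cdf a b).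

Lemma Fstar_cdf_low v : v <= a -> Fc v = 0.
Proof. by rewrite /Fstar_cdf => ->. Qed.

Lemma Fstar_cdf_mid v : a <= v -> v < b -> Fc v = 1 - a / v.
Proof.
move=> av vb; rewrite /Fstar_cdf vb; case: ifPn => // va.
have -> : v = a by apply/le_anti; rewrite va.
by rewrite divff ?gt_eqF// subrr.
Qed.

Lemma Fstar_cdf_high v : b <= v -> Fc v = 1.
Proof.
by move=> bv; rewrite /Fstar_cdf leNgt (lt_le_trans ab bv)/= ltNge bv.
Qed.

Lemma Fstar_cdf_ge0 v : 0 <= Fc v.
Proof.
rewrite /Fstar_cdf; case: (leP v a) => // av; case: (ltP v b) => _; last exact: ler01.
by rewrite subr_ge0 ler_pdivrMr ?mul1r ?ltW// (lt_trans a_gt0).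
Qed.

Lemma Fstar_cdf_le1 v : Fc v <= 1.
Proof.
rewrite /Fstar_cdf; case: (leP v a) => [_|av]; first exact: ler01.
case: (ltP v b) => // _.
by rewrite gerBl divr_ge0// ltW// (lt_trans a_gt0).
Qed.

Lemma Fstar_cdf_nd : nondecreasing Fc.
Proof.
move=> x y xy; have [xa|ax] := leP x a.
  by rewrite (Fstar_cdf_low xa) Fstar_cdf_ge0.
have [yb|bY] := ltP y b; last by rewrite (Fstar_cdf_high bY) Fstar_cdf_le1.
rewrite !Fstar_cdf_mid// ?(ltW ax)// ?(le_lt_trans xy)//; last first.
  by rewrite (le_trans (ltW ax)).
have x0 := lt_trans a_gt0 ax.
by rewrite lerB// ler_pM2l// lef_pV2// ?posrE// (lt_le_trans x0).
Qed.

Lemma exists_Fstar : exists P : probability (borel R) R, has_cdf P Fc.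
Proof.
apply: (@exists_probability_cdf _ _ 0 b Fstar_cdf_nd).
- by move=> x x0; rewrite Fstar_cdf_low// (le_trans (ltW x0))// ltW.
- by move=> x; exact: Fstar_cdf_high.
- move=> x; have [xb|bx] := ltP x b; last first.
    exists 1, 1; split=> // y xy _; rewrite (Fstar_cdf_high bx) mul1r.
    rewrite Fstar_cdf_high; last by rewrite (le_trans bx)// ltW.
    by rewrite lerDl subr_ge0 ltW.
  have [xa|ax] := ltP x a.
    exists 1, (a - x); split=> //; first by rewrite subr_gt0.
    move=> y xy; rewrite subrKC => ya.
    by rewrite !Fstar_cdf_low ?ltW// add0r mul1r subr_gt0.
  (* [1 / a] dominates the derivative [a / v^2] of [1 - a / v] for [v >= a]. *)
  exists a^-1, (b - x); split; [by rewrite subr_gt0|by rewrite invr_gt0|].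
  move=> y xy; rewrite subrKC => yb.
  have ay : a <= y by rewrite (le_trans ax)// ltW.
  rewrite !Fstar_cdf_mid//.
  have x0 : 0 < x by exact: lt_le_trans ax.
  have y0 : 0 < y by exact: lt_le_trans ay.
  rewrite -subr_ge0.
  have -> : 1 - a / x + a^-1 * (y - x) - (1 - a / y) =
      (y - x) * (x * y - a * a) / (a * x * y).
    by field; rewrite !gt_eqF.
  apply: divr_ge0; last by apply/ltW; rewrite mulr_gt0// mulr_gt0.
  by apply: mulr_ge0; rewrite subr_ge0 ?(ltW xy)// ler_pM// ltW.
Qed.

End Fstar.

Section Qstar.
Variables (R : realType) (a b : R).
Hypotheses (a_gt0 : 0 < a) (ab : a < b).
Local Notation Qc := (Qstar_cdf a b).

Definition Qstar_atom : R := (1 - a / b) * (ln b - ln a)^-1.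
Local Notation C := Qstar_atom.

Let b_gt0 : 0 < b. Proof. exact: lt_trans ab. Qed.

Let dln_gt0 : 0 < ln b - ln a.
Proof. by rewrite subr_gt0 ltr_ln ?posrE. Qed.

Lemma Qstar_atom_gt0 : 0 < C.
Proof.
by rewrite mulr_gt0 ?invr_gt0// subr_gt0 ltr_pdivrMr// mul1r.
Qed.

Lemma Qstar_cdf_neg r : r < 0 -> Qc r = 0.
Proof. by rewrite /Qstar_cdf => ->. Qed.

Lemma Qstar_cdf_low r : 0 <= r -> r <= a -> Qc r = C.
Proof. by rewrite /Qstar_cdf => r0 ->; rewrite ltNge r0. Qed.

Lemma Qstar_cdf_mid r : a < r -> r <= b ->
  Qc r = C * (r * (ln r - ln a)) / (r - a).
Proof.
move=> ar rb; rewrite /Qstar_cdf rb ltNge (ltW (lt_trans a_gt0 ar))/=.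
rewrite leNgt ar/= /C; field.
by rewrite (gt_eqF dln_gt0) subr_eq0 (gt_eqF ar) (gt_eqF b_gt0).
Qed.

(** At [b] itself the middle formula is in force, and [C] is the constant that makes it equal to
    [1]. *)
Lemma Qstar_cdf_high r : b <= r -> Qc r = 1.
Proof.
rewrite le_eqVlt => /predU1P[<-|br].
  rewrite Qstar_cdf_mid// /C; field.
  by rewrite (gt_eqF dln_gt0) subr_eq0 (gt_eqF ab) (gt_eqF b_gt0).
rewrite /Qstar_cdf (ltNge r 0) (ltW (lt_trans b_gt0 br))/=.
by rewrite leNgt (lt_trans ab br)/= leNgt br.
Qed.

(** Product form, which also covers [r = a], where the quotient reads [0 / 0]. *)
Lemma Qstar_cdf_mul r : a <= r -> r <= b ->
  (r - a) * Qc r = C * (r * (ln r - ln a)).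
Proof.
rewrite le_eqVlt => /predU1P[<-|ar] rb; first by rewrite !subrr mul0r !mulr0.
by rewrite Qstar_cdf_mid// mulrC divfK// subr_eq0 gt_eqF.
Qed.

Let Qstar_cdf_nd0 s t : 0 <= s -> s <= t -> t <= b -> Qc s <= Qc t.
Proof.
move=> s0 st tb; have [ta|at_] := leP t a.
  by rewrite !Qstar_cdf_low// ?(le_trans s0)// (le_trans st).
have t0 := lt_trans a_gt0 at_.
have ta0 : 0 < t - a by rewrite subr_gt0.
rewrite (Qstar_cdf_mid at_ tb) ler_pdivlMr//.
have [sa|as_] := leP s a.
  rewrite Qstar_cdf_low// ler_pM2l ?Qstar_atom_gt0//.
  have := ln_sub_ge a_gt0 t0; rewrite ler_pdivrMr// => h.
  by rewrite mulrC.
rewrite Qstar_cdf_mid// ?(le_trans st)//.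
rewrite [leLHS](_ : _ = C * (s * (ln s - ln a) * (t - a)) / (s - a)); last first.
  by field; rewrite subr_eq0 gt_eqF.
rewrite ler_pdivrMr ?subr_gt0// -(mulrA C) ler_pM2l ?Qstar_atom_gt0//.
exact: ln_weighted_slope_increasing.
Qed.

Lemma Qstar_cdf_ge0 r : 0 <= Qc r.
Proof.
have [r0|r0] := ltP r 0; first by rewrite Qstar_cdf_neg ?ler01.
have [rb|br] := leP r b; last by rewrite (Qstar_cdf_high (ltW br)).
apply: le_trans (Qstar_cdf_nd0 (lexx 0) r0 rb).
by rewrite Qstar_cdf_low ?(ltW Qstar_atom_gt0)// ltW.
Qed.

Lemma Qstar_cdf_le1 r : Qc r <= 1.
Proof.
have [r0|r0] := ltP r 0; first by rewrite Qstar_cdf_neg ?ler01.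
have [rb|br] := leP r b; last by rewrite (Qstar_cdf_high (ltW br)).
by rewrite -(Qstar_cdf_high (lexx b)) Qstar_cdf_nd0.
Qed.

Lemma Qstar_cdf_nd : nondecreasing Qc.
Proof.
move=> s t st; have [s0|s0] := ltP s 0.
  by rewrite (Qstar_cdf_neg s0) Qstar_cdf_ge0.
have [tb|bt] := leP t b; first exact: Qstar_cdf_nd0.
by rewrite (Qstar_cdf_high (ltW bt)) Qstar_cdf_le1.
Qed.

(** Monotonicity of [Q* r / r] in product form, which makes sense at [s = 0] too. It drives both the
    Lipschitz bound below and the monotonicity of [max_kernel]. *)
Lemma Qstar_cdf_ratio s t : 0 <= s -> s <= t -> t <= b -> s * Qc t <= t * Qc s.
Proof.
move=> s0 st tb; have [ta|at_] := leP t a.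
  rewrite !Qstar_cdf_low// ?(le_trans s0)// ?(le_trans st)//.
  by rewrite ler_wpM2r// ltW// Qstar_atom_gt0.
have t0 := lt_trans a_gt0 at_.
have ta0 : 0 < t - a by rewrite subr_gt0.
rewrite (Qstar_cdf_mid at_ tb) mulrA ler_pdivrMr//.
have [sa|as_] := leP s a.
  rewrite Qstar_cdf_low//.
  have := ln_sub_le a_gt0 t0; rewrite ler_pdivlMr// => h.
  have -> : s * (C * (t * (ln t - ln a))) = C * (t * (s * (ln t - ln a))) by ring.
  have -> : t * C * (t - a) = C * (t * (t - a)) by ring.
  rewrite ler_pM2l ?Qstar_atom_gt0// ler_pM2l//.
  apply: le_trans h; rewrite mulrC ler_wpM2l// subr_ge0 ler_ln ?posrE//.
  exact: ltW.
have s_gt0 := lt_trans a_gt0 as_.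
rewrite Qstar_cdf_mid// ?(le_trans st)//.
rewrite [leRHS](_ : _ = C * (t * (s * ((ln s - ln a) * (t - a)))) / (s - a)); last first.
  by field; rewrite subr_eq0 gt_eqF.
rewrite ler_pdivlMr ?subr_gt0//.
rewrite [leLHS](_ : _ = C * (t * (s * ((ln t - ln a) * (s - a))))); last by ring.
rewrite ler_pM2l ?Qstar_atom_gt0// ler_pM2l// ler_pM2l//.
exact: ln_slope_decreasing.
Qed.

(** For [t <= b] the ratio bound gives [Q* t - Q* s <= (t / s - 1) Q* s <= (t - s) / s]; a point [t]
    beyond [b] is replaced by [b], where [Q*] is already [1]. *)
Lemma Qstar_cdf_lip s t : 0 < s -> s <= t -> Qc t <= Qc s + s^-1 * (t - s).
Proof.
move=> s0 st.
have h0 : 0 <= s^-1 * (t - s) by rewrite mulr_ge0 ?subr_ge0// invr_ge0 ltW.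
have [tb|bt] := leP t b.
  have := Qstar_cdf_ratio (ltW s0) st tb.
  have := Qstar_cdf_le1 s; have := Qstar_cdf_ge0 s => q0 q1 h.
  rewrite -(ler_pM2l s0) mulrDr mulrA divff ?gt_eqF// mul1r.
  have : (t - s) * Qc s <= (t - s) by rewrite ler_piMr// subr_ge0.
  lra.
have [sb|bs] := leP b s; first by rewrite !Qstar_cdf_high// ?lerDl// ltW.
rewrite (Qstar_cdf_high (ltW bt)).
have := Qstar_cdf_ratio (ltW s0) (ltW bs) (lexx b).
rewrite (Qstar_cdf_high (lexx b)).
have := Qstar_cdf_le1 s; have := Qstar_cdf_ge0 s => q0 q1 h.
rewrite -(ler_pM2l s0) mulrDr (mulrA _ s^-1) divff ?gt_eqF// mul1r.
have : (b - s) * Qc s <= (b - s) by rewrite ler_piMr// subr_ge0 ltW.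
lra.
Qed.

Lemma exists_Qstar : exists P : probability (borel R) R, has_cdf P Qc.
Proof.
apply: (@exists_probability_cdf _ _ 0 b Qstar_cdf_nd).
- exact: Qstar_cdf_neg.
- exact: Qstar_cdf_high.
- move=> x; have [x0|] := ltP x 0.
    exists 1, (- x); split=> //; first by rewrite oppr_gt0.
    move=> y xy; rewrite subrr => y0.
    by rewrite !Qstar_cdf_neg// add0r mul1r subr_ge0 ltW.
  rewrite le_eqVlt => /predU1P[<-|x0].
    exists 1, a; split=> // y y0; rewrite add0r => ya.
    by rewrite !Qstar_cdf_low// ?lerDl ?(ltW ya) ?(ltW y0)// ?(ltW a_gt0)// mul1r subr0 ltW.
  exists x^-1, 1; split=> //; first by rewrite invr_gt0.
  by move=> y xy _; exact: Qstar_cdf_lip (ltW xy).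
Qed.

End Qstar.

(** * Integrals computed from a CDF *)

Section has_cdf_theory.
Variables (R : realType) (P : probability (borel R) R) (G : R -> R).
Hypothesis hP : has_cdf P G.

Lemma has_cdf_prob_le x : P `]-oo, x]%classic = (G x)%:E.
Proof. exact: hP. Qed.

Lemma has_cdf_prob_gt x : P `]x, +oo[%classic = (1 - G x)%:E.
Proof. by rewrite -setCitvl /= probability_setC// has_cdf_prob_le. Qed.

Lemma has_cdf_Rintegral_le x : \int[P]_r (r <= x)%R%:R = G x.
Proof.
rewrite (@Rintegral_nat _ _ _ P `]-oo, x]%classic)//=.
by rewrite has_cdf_prob_le.
Qed.

Lemma has_cdf_Rintegral_gt x : \int[P]_r (x < r)%R%:R = 1 - G x.
Proof.
rewrite (@Rintegral_nat _ _ _ P `]x, +oo[%classic)//=.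
  by rewrite has_cdf_prob_gt.
by move=> r; rewrite in_itv/= andbT.
Qed.

Lemma prob_lt_fineK x : P `]-oo, x[%classic = (fine (P `]-oo, x[%classic))%:E.
Proof. by rewrite fineK// fin_num_measure. Qed.

(** Continuity from below along []-oo, x - 1 / (n + 1)]]: the values of the CDF strictly left of [x]
    control the mass of the open half-line. *)
Lemma has_cdf_prob_lt_le x l : (forall y, y < x -> G y <= l) ->
  (P `]-oo, x[%classic <= l%:E)%E.
Proof.
move=> Gl; pose F n := `]-oo, x - n.+1%:R^-1]%classic : set (borel R).
have FE : \bigcup_n F n = `]-oo, x[%classic.
  apply/seteqP; split=> y.
    move=> [n _]; rewrite /F/= !in_itv/= => /le_lt_trans; apply.
    by rewrite ltrBlDr ltrDl.
  rewrite /= in_itv/= => yx; have /ltr_add_invr[k] := yx.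
  by exists k => //; rewrite /F/= in_itv/= lerBrDr ltW.
rewrite -FE.
have cvgP : P (F n) @[n --> \oo] --> P (\bigcup_n F n).
  apply: nondecreasing_cvg_mu.
  - by move=> i; exact: measurable_itv.
  - by apply: bigcup_measurable => i _; exact: measurable_itv.
  - move=> n m nm; apply/subsetPset => y; rewrite /F/= !in_itv/= => /le_trans.
    by apply; rewrite lerD2l lerN2 lef_pV2 ?posrE// ler_nat.
apply: (cvge_to_le cvgP); apply: nearW => n /=.
by rewrite has_cdf_prob_le lee_fin Gl// ltrBlDr ltrDl.
Qed.

Lemma has_cdf_prob_lt_ge x y : y < x -> ((G y)%:E <= P `]-oo, x[%classic)%E.
Proof.
move=> yx; rewrite -has_cdf_prob_le; apply: le_measure; rewrite ?inE//.
by move=> z; rewrite /= !in_itv/= => /le_lt_trans; exact.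
Qed.

Lemma Rintegral_lt x : \int[P]_r (r < x)%R%:R = fine (P `]-oo, x[%classic).
Proof.
by rewrite (@Rintegral_nat _ _ _ P `]-oo, x[%classic)//=.
Qed.

Lemma has_cdf_prob_itvcc lo hi : (forall x, x < lo -> G x = 0) -> G hi = 1 ->
  lo <= hi -> P `[lo, hi]%classic = 1%E.
Proof.
move=> G0 G1 lohi.
have -> : `[lo, hi]%classic = `]-oo, hi]%classic `\` `]-oo, lo[%classic :> set (borel R).
  apply/seteqP; split=> x; rewrite /= !in_itv/=.
    by move=> /andP[lx xh]; split=> //; apply/negP; rewrite -leNgt.
  by move=> [xh /negP]; rewrite -leNgt => ->.
rewrite measureD//=; last by rewrite has_cdf_prob_le ltry.
rewrite has_cdf_prob_le G1 setIidr; last first.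
  by move=> x; rewrite /= !in_itv/= => /ltW/le_trans; apply.
suff -> : P `]-oo, lo[%classic = 0%E by rewrite sube0.
apply/eqP; rewrite -measure_le0; apply: has_cdf_prob_lt_le => y /G0 ->.
exact: lexx.
Qed.

End has_cdf_theory.

Lemma probI1 d (T : measurableType d) (R : realType) (P : probability T R)
    (A B : set T) : measurable A -> measurable B -> P A = 1%E -> P B = 1%E ->
  P (A `&` B) = 1%E.
Proof.
move=> mA mB PA PB; rewrite -[A `&` B]setCK /= probability_setC; last first.
  by apply: measurableC; exact: measurableI.
have -> : P (~` (A `&` B)) = 0%E; last by rewrite sube0.
apply/eqP; rewrite -measure_le0 setCI.
apply: (le_trans (measureU2 _ _ _)); [exact: measurableC..|].
by rewrite /= !probability_setC// PA PB subee// adde0.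
Qed.

(** * Lebesgue integrals as expectations under a uniform law *)

Section uniform.
Variables (R : realType) (b : R) (b_gt0 : 0 < b).

(** Lebesgue integrals over [[0, b]] are written as [b] times an expectation under the uniform law,
    so that the calculus of [bounded_mfun] covers them. Here [h] is a globally defined integrand
    that cuts [f] off outside [[x, y[]. *)
Lemma uniform_FTC (h f H : R -> R) (x y : R) :
  0 <= x -> x < y -> y <= b ->
  measurable_fun [set: borel R] h -> (forall s, 0 <= h s) ->
  (forall s, x <= s -> s < y -> h s = f s) ->
  (forall s, s < x \/ y <= s -> h s = 0) ->
  (forall s, x <= s -> s <= y -> {for s, continuous f}) ->
  (forall s, x <= s -> s <= y -> is_derive s 1 H (f s)) ->
  b * \int[uniform_prob b_gt0]_s h s = H y - H x.
Proof.
move=> x0 xy yb mh h0 hf hz cf dH.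
rewrite /Rintegral integral_uniform//; last exact/measurable_EFinP.
have -> : (\int[lebesgue_measure]_(s in `[0%R, b]) (h s)%:E =
           \int[lebesgue_measure]_(s in `[x, y[) (h s)%:E)%E.
  rewrite integral_mkcond [RHS]integral_mkcond; apply: eq_integral => s _.
  rewrite !patchE !mem_setE !in_itv/=.
  have [xs|sx] := leP x s; last by rewrite hz; [case: ifP|left].
  have [sy|ys] := ltP s y; last by rewrite hz; [case: ifP|right].
  by rewrite (le_trans x0 xs) (le_trans (ltW sy) yb).
have -> : (\int[lebesgue_measure]_(s in `[x, y[) (h s)%:E =
           \int[lebesgue_measure]_(s in `[x, y[) (f s)%:E)%E.
  apply: eq_integral => s; rewrite inE/= in_itv/= => /andP[xs sy].
  by rewrite hf.
have cf' : {within `[x, y], continuous f}.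
  apply: continuous_in_subspaceT => s; rewrite inE/= in_itv/= => /andP[xs sy].
  exact: cf.
rewrite integral_itv_bndo_bndc; last first.
  apply/measurable_EFinP; apply: (@measurable_funS _ _ _ _ `[x, y]%classic) => //.
    by move=> s; rewrite /= !in_itv/= => /andP[-> /ltW].
  exact: subspace_continuous_measurable_fun.
rewrite (continuous_FTC2 xy cf' (F := H)).
- by rewrite subr0 /= mulrA divff ?mul1r// gt_eqF.
- split.
  + move=> s; rewrite in_itv/= => /andP[/ltW xs /ltW sy].
    by have [] := dH s xs sy.
  + have [dHx _] := dH x (lexx _) (ltW xy).
    exact/cvg_at_right_filter/differentiable_continuous/derivable1_diffP.
  + have [dHx _] := dH y (ltW xy) (lexx _).
    exact/cvg_at_left_filter/differentiable_continuous/derivable1_diffP.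
- move=> s; rewrite in_itv/= => /andP[/ltW xs /ltW sy].
  by rewrite derive1E; have [_] := dH s xs sy.
Qed.

Lemma uniform_itv (x y : R) : 0 <= x -> x <= y -> y <= b ->
  b * \int[uniform_prob b_gt0]_s ((x <= s) && (s < y))%:R = y - x.
Proof.
move=> x0; rewrite le_eqVlt => /predU1P[<-|xy] yb.
  rewrite subrr (_ : (fun s => _) = (fun=> 0)) ?prob_Rintegral_cst ?mulr0//.
  apply/funext => s; case: leP => //= xs; by rewrite ltNge xs.
apply: (@uniform_FTC _ (fun=> 1) idfun) => //.
- apply: (proj1 (@bounded_mfun_nat _ (borel R) R _ _)).
  by apply: measurable_and; [exact: measurable_fun_ler|exact: measurable_fun_ltr].
- by move=> s xs sy; rewrite xs sy.
- by move=> s [sx|ys]; [rewrite leNgt sx|rewrite (ltNge s) ys andbF].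
- by move=> s _ _; exact: cvg_cst.
Qed.

End uniform.

(** * Positive semidefiniteness of [min] *)

Section min_kernel.
Context d (T : measurableType d) (R : realType).

(** Two applications of Fubini move [s] to the outside, where for fixed [s] the kernel splits into a
    function of [x] times a function of [y]. *)
Lemma Rintegral_product_kernel d' (S : measurableType d')
    (P1 P2 : probability T R) (U : probability S R) (g : S * T -> R) :
  bounded_mfun g ->
  \int[P1]_x \int[P2]_y \int[U]_s (g (s, x) * g (s, y)) =
  \int[U]_s ((\int[P1]_x g (s, x)) * (\int[P2]_y g (s, y))).
Proof.
move=> bg.
have bgx x : bounded_mfun (fun s => g (s, x)) by exact: bounded_mfun_comp bg.
have bgs s : bounded_mfun (fun x => g (s, x)) by exact: bounded_mfun_comp bg.
have E x : \int[P2]_y \int[U]_s (g (s, x) * g (s, y)) =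
           \int[U]_s (g (s, x) * \int[P2]_y g (s, y)).
  rewrite (@bounded_Fubini _ _ _ _ _ P2 U
    (fun z : T * S => g (z.2, x) * g (z.2, z.1))).
    by apply: eq_Rintegral => s _ /=; rewrite bRintegralZ.
  apply: bounded_mfunM.
    exact: (bounded_mfun_comp measurable_snd (bgx x)).
  apply: (bounded_mfun_comp (h := fun z : T * S => (z.2, z.1)) _ bg).
  exact: measurable_fun_pair.
under eq_Rintegral do rewrite E.
have bI2 := bounded_mfun_Rintegral P2 bg.
rewrite (@bounded_Fubini _ _ _ _ _ P1 U
  (fun z : T * S => g (z.2, z.1) * \int[P2]_y g (z.2, y))).
  apply: eq_Rintegral => s _ /=; under eq_Rintegral do rewrite mulrC.
  by rewrite bRintegralZ// mulrC.
apply: bounded_mfunM.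
  apply: (bounded_mfun_comp (h := fun z : T * S => (z.2, z.1)) _ bg).
  exact: measurable_fun_pair.
exact: (bounded_mfun_comp measurable_snd bI2).
Qed.

(* Layer-cake representation: [min (f x) (f y)] is the integral over [s] of the
   product kernel [1 (s < f x) * 1 (s < f y)]. *)
Lemma min_kernel_psd (P1 P2 : probability T R) (f : T -> R) :
  bounded_mfun f -> (forall x, 0 <= f x) ->
  2 * \int[P1]_x \int[P2]_y Num.min (f x) (f y) <=
  \int[P1]_x \int[P1]_y Num.min (f x) (f y) +
  \int[P2]_x \int[P2]_y Num.min (f x) (f y).
Proof.
move=> bf f0; have [mf [k fk]] := bf.
pose M := `|k| + 1.
have M0 : 0 < M by rewrite ltr_pwDr.
pose U := uniform_prob M0.
pose g (z : borel R * T) : R := ((0 <= z.1) && (z.1 < f z.2))%:R.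
have bg : bounded_mfun g.
  apply: bounded_mfun_nat; apply: measurable_and.
    by apply: measurable_fun_ler => //; exact: measurable_fst.
  apply: measurable_fun_ltr; first exact: measurable_fst.
  by apply: measurableT_comp mf _; exact: measurable_snd.
have minE x y : Num.min (f x) (f y) = M * \int[U]_s (g (s, x) * g (s, y)).
  rewrite -[LHS]subr0 -(@uniform_itv _ _ M0)//; last 2 first.
  - by rewrite le_min !f0.
  - rewrite ge_min; apply/orP; left.
    by rewrite (le_trans (ler_norm _))// (le_trans (fk x))// (le_trans (ler_norm _))// lerDl.
  congr (_ * _); apply: eq_Rintegral => s _; rewrite /g/= lt_min -natrM mulnb.
  by case: (0 <= s).
have E (P P' : probability T R) : \int[P]_x \int[P']_y Num.min (f x) (f y) =
    M * \int[U]_s ((\int[P]_x g (s, x)) * (\int[P']_y g (s, y))).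
  rewrite -Rintegral_product_kernel// -bRintegralZ; last first.
    apply: (@bounded_mfun_Rintegral _ _ T T R P' (fun z => \int[U]_s (g (s, z.1) * g (s, z.2)))).
    apply: (@bounded_mfun_Rintegral _ _ (T * T)%type (borel R) R U
       (fun z => g (z.2, z.1.1) * g (z.2, z.1.2))).
    apply: bounded_mfunM.
      apply: (bounded_mfun_comp (h := fun z : (T * T) * borel R => (z.2, z.1.1)) _ bg).
      apply: measurable_fun_pair => //; apply: measurableT_comp => //.
    apply: (bounded_mfun_comp (h := fun z : (T * T) * borel R => (z.2, z.1.2)) _ bg).
    by apply: measurable_fun_pair => //; apply: measurableT_comp.
  apply: eq_Rintegral => x _; rewrite -bRintegralZ; last first.
    apply: (@bounded_mfun_Rintegral _ _ T (borel R) R U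
       (fun z => g (z.2, x) * g (z.2, z.1))).
    apply: bounded_mfunM.
      apply: (bounded_mfun_comp (h := fun z : T * borel R => (z.2, x)) _ bg).
      exact: measurable_fun_pair.
    apply: (bounded_mfun_comp (h := fun z : T * borel R => (z.2, z.1)) _ bg).
    exact: measurable_fun_pair.
  by apply: eq_Rintegral => y _; rewrite minE.
have b1 := bounded_mfun_Rintegral P1 bg.
have b2 := bounded_mfun_Rintegral P2 bg.
rewrite !E mulrCA -mulrDr ler_pM2l// -bRintegralZ; last exact: bounded_mfunM.
rewrite -bRintegralD; [|exact: bounded_mfunM..].
apply: le_bRintegral.
- by apply: bounded_mfunM; [exact: bounded_mfun_cst|exact: bounded_mfunM].
- by apply: bounded_mfunD; exact: bounded_mfunM.
(* At each level [s] the two integrands differ by the square of [A - B]. *)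
- move=> s /=; rewrite -subr_ge0.
  set A := \int[P1]_x _; set B := \int[P2]_x _.
  have -> : A * A + B * B - 2 * (A * B) = (A - B) ^+ 2 by ring.
  exact: sqr_ge0.
Qed.

End min_kernel.

(** * Expected payments of the auction with a random reserve *)

Definition sale_pay (R : realType) (r v w : R) : R :=
  if r < Num.max v w then Num.max r (Num.min v w) else 0.

Definition window (R : realType) (x y s : R) : R := ((x <= s) && (s < y))%:R.

Lemma windowM (R : realType) (x y t s : R) :
  window x y s * (t <= s)%R%:R = window (Num.max x t) y s.
Proof. by rewrite /window -natrM mulnb ge_max andbAC. Qed.

Lemma bounded_mfun_window d (T : measurableType d) (R : realType)
    (x y s : T -> R) : measurable_fun [set: T] x -> measurable_fun [set: T] y ->
  measurable_fun [set: T] s -> bounded_mfun (fun z => window (x z) (y z) (s z)).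
Proof.
move=> mx my ms; apply: bounded_mfun_nat; apply: measurable_and.
  exact: measurable_fun_ler.
exact: measurable_fun_ltr.
Qed.

Section window_integral.
Variables (R : realType) (b : R) (b_gt0 : 0 < b).
Local Notation U := (uniform_prob b_gt0).

Lemma uniform_window (x y : R) : 0 <= x -> x <= y -> y <= b ->
  b * \int[U]_s window x y s = y - x.
Proof. exact: uniform_itv. Qed.

(** Layer-cake formula for the projection of [t] to [[x, y]]: it falls short of [y] by the length of
    the part of [[x, y[] to the right of [t]. In this form [t] enters only through [t <= s], whose
    expectation is a CDF. *)
Lemma min_max_window (x y t : R) : 0 <= x -> x <= y -> y <= b ->
  Num.min y (Num.max x t) = y - b * \int[U]_s (window x y s * (t <= s)%R%:R).
Proof.
move=> x0 xy yb; under eq_Rintegral do rewrite windowM.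
have [ty|yt] := ltP t y.
  rewrite uniform_window// ?le_max ?x0// ?ge_max ?xy ?(ltW ty)//.
  by rewrite subKr; apply/min_idPr; rewrite ge_max xy ltW.
rewrite (_ : (fun s => _) = (fun=> 0)).
  by rewrite prob_Rintegral_cst mulr0 subr0; apply/min_idPl; rewrite le_max yt orbT.
apply/funext => s; rewrite /window ge_max; case: (leP t s) => [ts|]; last by rewrite andbF.
by rewrite ltNge (le_trans yt ts) andbF.
Qed.

Lemma bounded_mfun_le d (T : measurableType d) (x y : T -> R) :
  measurable_fun [set: T] x -> measurable_fun [set: T] y ->
  bounded_mfun (fun z => (x z <= y z)%R%:R : R).
Proof. by move=> mx my; apply: bounded_mfun_nat; exact: measurable_fun_ler. Qed.

Lemma bounded_mfun_lt d (T : measurableType d) (x y : T -> R) :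
  measurable_fun [set: T] x -> measurable_fun [set: T] y ->
  bounded_mfun (fun z => (x z < y z)%R%:R : R).
Proof. by move=> mx my; apply: bounded_mfun_nat; exact: measurable_fun_ltr. Qed.

(** Fubini in place of integration by parts: integrating [t <= s] over [t] first produces the CDF at
    [s]. *)
Lemma Rintegral_window_cdf (P : probability (borel R) R) (G : R -> R) (x y : R)
    (f : R -> R) : has_cdf P G ->
  bounded_mfun (fun s : borel R => window x y s * f s) ->
  \int[P]_t \int[U]_s (window x y s * f s * (t <= s)%R%:R) =
  \int[U]_s (window x y s * f s * G s).
Proof.
move=> hP bwf.
rewrite (@bounded_Fubini _ _ _ _ _ P U
  (fun z : borel R * borel R => window x y z.2 * f z.2 * (z.1 <= z.2)%R%:R)).
  apply: eq_Rintegral => s _ /=; rewrite bRintegralZ; last first.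
    exact: bounded_mfun_le.
  by rewrite (has_cdf_Rintegral_le hP).
apply: bounded_mfunM; first exact: (bounded_mfun_comp measurable_snd bwf).
by apply: bounded_mfun_le; [exact: measurable_fst|exact: measurable_snd].
Qed.

Lemma bounded_mfun_window_cdf (P : probability (borel R) R) (x y : R)
    (f : R -> R) :
  bounded_mfun (fun s : borel R => window x y s * f s) ->
  bounded_mfun (fun t : borel R => \int[U]_s (window x y s * f s * (t <= s)%R%:R)).
Proof.
move=> bwf.
apply: (@bounded_mfun_Rintegral _ _ (borel R) (borel R) R U
  (fun z => window x y z.2 * f z.2 * (z.1 <= z.2)%R%:R)).
apply: bounded_mfunM; first exact: (bounded_mfun_comp measurable_snd bwf).
by apply: bounded_mfun_le; [exact: measurable_fst|exact: measurable_snd].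
Qed.

End window_integral.

(** In a tie the two shares add up to [1] and both bidders face the same price, so the tie rule
    disappears from the total. *)
Lemma sum_spa_pay (R : realType) (tie : R * R -> R) (r v w : R) :
  \sum_(i < 2) spa_pay tie r i (v, w) = sale_pay r v w.
Proof.
rewrite big_ord_recl big_ord1 /spa_pay /spa_alloc /sale_pay /own_bid /other_bid.
rewrite /tie_share /=; case: ifP => [rm|_]; last by rewrite !mulr0 addr0.
by case: ltgtP => [vw|wv|<-]; rewrite ?mulr0 ?mulr1 ?addr0 ?add0r// -mulrDr subrKC mulr1.
Qed.

Section revenue_kernel.
Variables (R : realType) (a b : R).
Hypotheses (a_gt0 : 0 < a) (ab : a < b) (b_gt0 : 0 < b).
Variables (Q : probability (borel R) R).
Hypothesis hQ : has_cdf Q (Qstar_cdf a b).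
Local Notation U := (uniform_prob b_gt0).
Local Notation Qc := (Qstar_cdf a b).

Lemma bounded_mfun_Qstar_cdf : bounded_mfun (Qc : borel R -> R).
Proof.
split.
  by apply: nondecreasing_measurable => //; exact: Qstar_cdf_nd.
by exists 1 => x; rewrite ger0_norm ?Qstar_cdf_ge0// Qstar_cdf_le1.
Qed.

(** [Q*] has no atom at a positive point, because [Qstar_cdf_lip] makes it left continuous there. *)
Lemma Qstar_prob_lt x : 0 < x -> \int[Q]_r (r < x)%R%:R = Qc x.
Proof.
move=> x0; rewrite Rintegral_lt; apply/le_anti/andP; split.
  rewrite -lee_fin -prob_lt_fineK; apply: (has_cdf_prob_lt_le hQ) => y yx.
  exact/Qstar_cdf_nd/ltW.
apply/ler_addgt0Pr => e e0.
(* The gap [(x - y) / y = d / (1 - d)] is at most [2 d <= e], since [d <= 1 / 2]. *)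
pose d := Num.min e 1 / 2.
have m0 : 0 < Num.min e 1 by rewrite lt_min e0 ltr01.
have d0 : 0 < d by rewrite divr_gt0.
have d1 : d * 2 <= 1 by rewrite /d divfK// ge_min lexx orbT.
have de : d * 2 <= e by rewrite /d divfK// ge_min lexx.
pose y := x * (1 - d).
have y0 : 0 < y by rewrite mulr_gt0// subr_gt0; lra.
have yx : y < x by rewrite /y gtr_pMr//; lra.
have := has_cdf_prob_lt_ge hQ yx; rewrite prob_lt_fineK lee_fin => h.
apply: (le_trans (Qstar_cdf_lip a_gt0 ab y0 (ltW yx))).
apply: lerD => //; rewrite ler_pdivrMl//.
by rewrite /y -mulrA -[X in X - _]mulr1 -mulrBr ler_pM2l//; nra.
Qed.

(** At [x = 0] the strict and the weak probability differ by the atom, and the factor [x] hides the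
    difference. *)
Lemma Qstar_prob_lt_mul x : 0 <= x -> x * \int[Q]_r (r < x)%R%:R = x * Qc x.
Proof.
rewrite le_eqVlt => /predU1P[<-|x0]; first by rewrite !mul0r.
by rewrite Qstar_prob_lt.
Qed.

Lemma sale_pay_window (r l h : R) : 0 <= l -> l <= h -> h <= b ->
  (if r < h then Num.max r l else 0) =
  h * (r < h)%R%:R - b * \int[U]_s (window l h s * 1 * (r <= s)%R%:R).
Proof.
move=> l0 lh hb; under eq_Rintegral do rewrite mulr1.
have := min_max_window b_gt0 r l0 lh hb.
case: ltP => rh.
  by rewrite mulr1 => <-; rewrite maxC; apply/esym/min_idPr; rewrite ge_max lh ltW.
rewrite mulr0 sub0r.
have -> : Num.min h (Num.max l r) = h by apply/min_idPl; rewrite le_max rh orbT.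
by set I := b * _; lra.
Qed.

(** Averaging over the reserve turns [r < h] into [Q* h] and [r <= s] into [Q* s]: the larger bid
    times the probability of a sale, minus the area under [Q*] between the two bids. *)
Lemma expected_sale_pay (v w : R) : 0 <= v -> v <= b -> 0 <= w -> w <= b ->
  \int[Q]_r sale_pay r v w =
  Num.max v w * Qc (Num.max v w) -
  b * \int[U]_s (window (Num.min v w) (Num.max v w) s * Qc s).
Proof.
move=> v0 vb w0 wb; rewrite /sale_pay.
set l := Num.min v w; set h := Num.max v w.
have l0 : 0 <= l by rewrite le_min v0.
have lh : l <= h by rewrite ge_min /h le_max lexx.
have hb : h <= b by rewrite ge_max vb.
have bw : bounded_mfun (fun s : borel R => window l h s * 1).
  apply: bounded_mfunM; last exact: bounded_mfun_cst.
  exact: bounded_mfun_window.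
under eq_Rintegral do rewrite sale_pay_window//.
have bW := bounded_mfun_window_cdf b_gt0 Q bw.
have bl : bounded_mfun (fun r : borel R => (r < h)%R%:R : R).
  exact: bounded_mfun_lt.
rewrite bRintegralB; last 2 first.
- by apply: bounded_mfunM => //; exact: bounded_mfun_cst.
- by apply: bounded_mfunM => //; exact: bounded_mfun_cst.
rewrite bRintegralZ// bRintegralZ// Qstar_prob_lt_mul ?(le_trans l0)//.
rewrite (Rintegral_window_cdf b_gt0 hQ bw).
by congr (_ - b * _); apply: eq_Rintegral => s _; rewrite mulr1.
Qed.

End revenue_kernel.

(** * Antiderivatives for the explicit integrals *)

Lemma is_derive_xlnx (R : realType) (k a s : R) : 0 < s ->
  is_derive s 1 (fun x : R => k * (x * (ln x - ln a) - x)) (k * (ln s - ln a)).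
Proof.
move=> s0; have d1 := is_derive1_ln s0.
have -> : (fun x : R => k * (x * (ln x - ln a) - x)) =
    (cst k * (id * (@ln R - cst (ln a)) - id) : R -> R) by apply/funext.
by apply: is_derive_eq; rewrite /GRing.scale !fctE /=; field; rewrite gt_eqF.
Qed.

Lemma is_derive_subMln (R : realType) (a s : R) : 0 < s ->
  is_derive s 1 (fun x : R => x - a * ln x) (1 - a / s).
Proof.
move=> s0; have d1 := is_derive1_ln s0.
have -> : (fun x : R => x - a * ln x) = (id - cst a * @ln R : R -> R).
  by apply/funext.
by apply: is_derive_eq; rewrite /GRing.scale !fctE /=; field; rewrite gt_eqF.
Qed.

Lemma is_derive_half_sqr (R : realType) (k s : R) :
  is_derive s 1 (fun x : R => k * x ^+ 2 / 2) (k * s).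
Proof.
have -> : (fun x : R => k * x ^+ 2 / 2) = (cst k * id * id * cst 2^-1 : R -> R).
  by apply/funext => x; rewrite expr2 /= /cst/= !mulrA.
by apply: is_derive_eq; rewrite /GRing.scale !fctE /=; field.
Qed.

(** Projection to [[0, b]]: it is the identity on the support of the laws considered and turns
    kernels on the whole line into bounded functions. *)
Definition clip (R : realType) (b x : R) : R := Num.min b (Num.max 0 x).

Section clip.
Variables (R : realType) (b : R).
Hypothesis b_gt0 : 0 < b.

Lemma clip_ge0 x : 0 <= clip b x.
Proof. by rewrite le_min (ltW b_gt0) le_max lexx. Qed.

Lemma clip_le x : clip b x <= b.
Proof. by rewrite ge_min lexx. Qed.

Lemma clip_id x : 0 <= x -> x <= b -> clip b x = x.
Proof.
by move=> x0 xb; rewrite /clip (max_idPr x0); apply/min_idPr.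
Qed.

Lemma bounded_mfun_clip : bounded_mfun (clip b : borel R -> R).
Proof.
split; last by exists b => x; rewrite ger0_norm ?clip_ge0// clip_le.
apply: (@measurable_minr _ _ _ _ (fun=> b)) => //.
exact: (@measurable_maxr _ _ _ _ (fun=> 0)).
Qed.

End clip.

(** * The revenue kernel and its bilinear form *)

Section kernel.
Variables (R : realType) (a b : R).
Hypotheses (a_gt0 : 0 < a) (ab : a < b).
Variable b_gt0 : 0 < b.
Local Notation U := (uniform_prob b_gt0).
Local Notation Qc := (Qstar_cdf a b).
Local Notation Qc_ge0 := (Qstar_cdf_ge0 a_gt0 ab).

(** The factor [b] undoes the normalisation of the uniform law: for [0 <= x <= b] this is the
    Lebesgue integral of [Q*] over [[0, x]]. *)
Definition Qstar_area (x : R) : R := b * \int[U]_s (window 0 x s * Qc s).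
Local Notation Phi := Qstar_area.

Let bounded_windowQ x y : bounded_mfun (fun s : borel R => window x y s * Qc s).
Proof.
by apply: bounded_mfunM; [exact: bounded_mfun_window|exact: bounded_mfun_Qstar_cdf].
Qed.

Lemma Qstar_areaB x y : 0 <= x -> x <= y ->
  b * \int[U]_s (window x y s * Qc s) = Phi y - Phi x.
Proof.
move=> x0 xy; rewrite /Phi -mulrBr -bRintegralB//; congr (_ * _).
apply: eq_Rintegral => s _; rewrite -mulrBl; congr (_ * _).
rewrite /window; have [xs|sx] := leP x s.
  by rewrite (le_trans x0 xs) /= subr0.
by rewrite (lt_le_trans sx xy) /= !andbT subrr.
Qed.

Definition max_kernel (x : R) : R := x * Qc x - 2 * Phi x.
Local Notation g := max_kernel.

(* [Qc s >= s * Qc y / y] on [[x, y]] bounds the area from below by that of a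
   trapezoid. *)
Lemma max_kernel_nonincreasing x y : 0 <= x -> x <= y -> y <= b -> g y <= g x.
Proof.
move=> x0; rewrite le_eqVlt => /predU1P[->//|xy] yb.
have y0 : 0 < y by exact: le_lt_trans xy.
pose k := Qc y / y.
have k0 : 0 <= k by rewrite divr_ge0 ?Qc_ge0// ltW.
have bh : bounded_mfun (fun s : borel R => window x y s * (k * clip b s)).
  apply: bounded_mfunM; first exact: bounded_mfun_window.
  by apply: bounded_mfunM; [exact: bounded_mfun_cst|exact: bounded_mfun_clip].
have A : b * \int[U]_s (window x y s * (k * clip b s)) =
    k * y ^+ 2 / 2 - k * x ^+ 2 / 2.
  apply: (@uniform_FTC _ _ b_gt0 _ (fun s => k * s) (fun s => k * s ^+ 2 / 2)
    x y x0 xy yb (proj1 bh)).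
  - by move=> s; rewrite mulr_ge0// mulr_ge0// clip_ge0.
  - move=> s xs sy; rewrite /window xs sy mul1r clip_id//.
      exact: le_trans xs.
    by rewrite (le_trans (ltW sy)).
  - move=> s [sx|ys]; rewrite /window; first by rewrite leNgt sx mul0r.
    by rewrite (ltNge s) ys andbF mul0r.
  - by move=> s _ _; apply: cvgM; [exact: cvg_cst|exact: cvg_id].
  - by move=> s _ _; exact: is_derive_half_sqr.
have B : k * y ^+ 2 / 2 - k * x ^+ 2 / 2 <= Phi y - Phi x.
  rewrite -A -(Qstar_areaB x0 (ltW xy)) ler_pM2l//.
  apply: le_bRintegral => // s; rewrite /window.
  case: andP => [[xs sy]|_]; last by rewrite !mul0r.
  have s0 : 0 <= s by exact: le_trans xs.
  rewrite !mul1r clip_id//; last by rewrite (le_trans (ltW sy)).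
  rewrite /k mulrAC ler_pdivrMr// mulrC [leRHS]mulrC.
  exact: (Qstar_cdf_ratio a_gt0 ab s0 (ltW sy) yb).
have ky : k * y = Qc y by rewrite divfK// gt_eqF.
have kx : k * x <= Qc x.
  rewrite /k mulrAC ler_pdivrMr// mulrC [leRHS]mulrC.
  exact: (Qstar_cdf_ratio a_gt0 ab x0 (ltW xy) yb).
(* Using [Q* y = k y], the trapezoid bound leaves [g y - g x <= k x^2 - x Q* x], which is
   nonpositive. *)
have kxx : x * (k * x) <= x * Qc x by rewrite ler_wpM2l.
rewrite /g -ky; lra.
Qed.

(** For bids [l <= h] the expected payment [h Q* h - (Phi h - Phi l)] is [Phi l + Phi h + g h],
    which separates an additive part from a function of the maximum. Clipping extends it to all
    bids. *)
Definition sale_kernel (v w : R) : R :=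
  Phi (clip b v) + Phi (clip b w) + g (Num.max (clip b v) (clip b w)).

(** Subtracting the minimum [g b] makes the function nonnegative, as the layer-cake argument in
    [min_kernel_psd] requires. *)
Let gap (x : R) : R := g (clip b x) - g b.

Let gap_ge0 x : 0 <= gap x.
Proof.
by rewrite subr_ge0 max_kernel_nonincreasing ?clip_ge0 ?clip_le.
Qed.

Let sale_kernelE v w : sale_kernel v w =
  Phi (clip b v) + Phi (clip b w) + g b + Num.min (gap v) (gap w).
Proof.
rewrite /sale_kernel /gap.
have gc x y : clip b x <= clip b y -> g (clip b y) - g b <= g (clip b x) - g b.
  by move=> xy; rewrite lerB// max_kernel_nonincreasing ?clip_ge0 ?clip_le.
case: (leP (clip b v) (clip b w)) => [vw|/ltW vw].
  by rewrite (min_idPr (gc _ _ vw)); ring.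
by rewrite (min_idPl (gc _ _ vw)); ring.
Qed.

Let bounded_area : bounded_mfun (fun x : borel R => Phi (clip b x)).
Proof.
apply: (@bounded_mfunM _ _ _ (fun=> b)); first exact: bounded_mfun_cst.
apply: (@bounded_mfun_Rintegral _ _ (borel R) (borel R) R U
  (fun z => window 0 (clip b z.1) z.2 * Qc z.2)).
apply: bounded_mfunM; last first.
  exact: (bounded_mfun_comp measurable_snd (bounded_mfun_Qstar_cdf a_gt0 ab)).
apply: bounded_mfun_window => //.
apply: measurableT_comp; last exact: measurable_fst.
exact: (proj1 (bounded_mfun_clip b_gt0)).
Qed.

Let bounded_gap : bounded_mfun (gap : borel R -> R).
Proof.
apply: bounded_mfunB; last exact: bounded_mfun_cst.
have bc := bounded_mfun_clip b_gt0.
apply: bounded_mfunB; last first.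
  by apply: bounded_mfunM; [exact: bounded_mfun_cst|exact: bounded_area].
apply: bounded_mfunM => //.
exact: (bounded_mfun_comp (proj1 bc) (bounded_mfun_Qstar_cdf a_gt0 ab)).
Qed.

Let bounded_area1 : bounded_mfun (fun z : borel R * borel R => Phi (clip b z.1)).
Proof. exact: (bounded_mfun_comp measurable_fst bounded_area). Qed.

Let bounded_area2 : bounded_mfun (fun z : borel R * borel R => Phi (clip b z.2)).
Proof. exact: (bounded_mfun_comp measurable_snd bounded_area). Qed.

Let bounded_min_gap :
  bounded_mfun (fun z : borel R * borel R => Num.min (gap z.1) (gap z.2)).
Proof.
apply: bounded_mfun_min.
- exact: (bounded_mfun_comp measurable_fst bounded_gap).
- exact: (bounded_mfun_comp measurable_snd bounded_gap).
Qed.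

Lemma bounded_mfun_sale_kernel :
  bounded_mfun (fun z : borel R * borel R => sale_kernel z.1 z.2).
Proof.
rewrite (_ : (fun z => _) = (fun z : borel R * borel R =>
  Phi (clip b z.1) + Phi (clip b z.2) + g b + Num.min (gap z.1) (gap z.2))).
  apply: bounded_mfunD => //; apply: bounded_mfunD; last exact: bounded_mfun_cst.
  exact: bounded_mfunD.
by apply/funext => z; rewrite sale_kernelE.
Qed.

Definition cross_revenue (P1 P2 : probability (borel R) R) : R :=
  \int[P1]_v \int[P2]_w sale_kernel v w.

Let cross_revenueE (P1 P2 : probability (borel R) R) : cross_revenue P1 P2 =
  \int[P1]_x Phi (clip b x) + \int[P2]_x Phi (clip b x) + g b +
  \int[P1]_x \int[P2]_y Num.min (gap x) (gap y).
Proof.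
have bm := bounded_mfun_Rintegral P2 bounded_min_gap.
have bc k : bounded_mfun (fun _ : borel R => k) := bounded_mfun_cst _ k.
have E v : \int[P2]_w sale_kernel v w = Phi (clip b v) +
    \int[P2]_x Phi (clip b x) + g b + \int[P2]_y Num.min (gap v) (gap y).
  under eq_Rintegral do rewrite sale_kernelE.
  rewrite !bRintegralD ?prob_Rintegral_cst//.
  - exact: bounded_mfunD.
  - by do 2?apply: bounded_mfunD.
  - exact: bounded_mfun_min.
rewrite /cross_revenue; under eq_Rintegral do rewrite E.
rewrite !bRintegralD ?prob_Rintegral_cst//.
- exact: bounded_mfunD.
- by do 2?apply: bounded_mfunD.
Qed.

(** The additive part of the kernel contributes equally to both sides; what remains is
    [min_kernel_psd] for [gap]. *)
Lemma cross_revenue_psd (P1 P2 : probability (borel R) R) :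
  2 * cross_revenue P1 P2 <= cross_revenue P1 P1 + cross_revenue P2 P2.
Proof.
have := min_kernel_psd P1 P2 bounded_gap gap_ge0.
rewrite !cross_revenueE; lra.
Qed.

Lemma expected_sale_pay_kernel (Q : probability (borel R) R) (v w : R) :
  has_cdf Q Qc -> 0 <= v -> v <= b -> 0 <= w -> w <= b ->
  \int[Q]_r sale_pay r v w = sale_kernel v w.
Proof.
move=> hQ v0 vb w0 wb; rewrite (expected_sale_pay a_gt0 ab b_gt0 hQ)//.
rewrite Qstar_areaB; last 2 first.
- by rewrite le_min v0.
- by rewrite ge_min le_max lexx.
rewrite /sale_kernel /g !clip_id//.
by case: leP => vw; ring.
Qed.

End kernel.

(** * First-order condition at [F*] *)

Section first_order.
Variables (R : realType) (a b : R).
Hypotheses (a_gt0 : 0 < a) (ab : a < b).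
Variable b_gt0 : 0 < b.
Variables (F Q : probability (borel R) R).
Hypotheses (hF : has_cdf F (Fstar_cdf a b)) (hQ : has_cdf Q (Qstar_cdf a b)).
Local Notation U := (uniform_prob b_gt0).
Local Notation Qc := (Qstar_cdf a b).
Local Notation Fc := (Fstar_cdf a b).
Local Notation C := (Qstar_atom a b).

Lemma Fstar_support : F `[0, b]%classic = 1%E.
Proof.
apply: (has_cdf_prob_itvcc hF); last exact: ltW.
- by move=> x x0; rewrite Fstar_cdf_low// ltW// (lt_trans x0).
- exact: Fstar_cdf_high.
Qed.

Lemma bounded_mfun_Fstar_cdf : bounded_mfun (Fc : borel R -> R).
Proof.
split.
  by apply: nondecreasing_measurable => //; exact: Fstar_cdf_nd.
by exists 1 => x; rewrite ger0_norm ?Fstar_cdf_ge0// Fstar_cdf_le1.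
Qed.

Let bounded_windowF x y : bounded_mfun (fun s : borel R => window x y s * Fc s).
Proof.
by apply: bounded_mfunM; [exact: bounded_mfun_window|exact: bounded_mfun_Fstar_cdf].
Qed.

Let bounded_window1 x y : bounded_mfun (fun s : borel R => window x y s * 1).
Proof.
by apply: bounded_mfunM; [exact: bounded_mfun_window|exact: bounded_mfun_cst].
Qed.

(** By the layer-cake formula the mean is [b] minus the area under [F*]; on [[a, b[] an
    antiderivative of [F*] is [s - a ln s]. *)
Lemma Fstar_mean : \int[F]_w clip b w = a * (1 + ln b - ln a).
Proof.
have bc := bounded_mfun_clip b_gt0.
have E w : clip b w = b - b * \int[U]_s (window 0 b s * 1 * (w <= s)%R%:R).
  under eq_Rintegral do rewrite mulr1.
  by rewrite /clip (min_max_window b_gt0)// ltW.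
under eq_Rintegral do rewrite E.
have bW := bounded_mfun_window_cdf b_gt0 F (bounded_window1 0 b).
rewrite bRintegralB; last 2 first.
- exact: bounded_mfun_cst.
- by apply: bounded_mfunM => //; exact: bounded_mfun_cst.
rewrite prob_Rintegral_cst bRintegralZ// (Rintegral_window_cdf b_gt0 hF)//.
under eq_Rintegral do rewrite mulr1.
suff -> : b * \int[U]_s (window 0 b s * Fc s) = (b - a * ln b) - (a - a * ln a).
  by ring.
apply: (@uniform_FTC _ _ b_gt0 _ (fun s => 1 - a / s) (fun s => s - a * ln s)
  a b (ltW a_gt0) ab (lexx b) (proj1 (bounded_windowF 0 b))).
- by move=> s; rewrite mulr_ge0// Fstar_cdf_ge0.
- move=> s as_ sb; rewrite /window (le_trans (ltW a_gt0) as_) sb mul1r.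
  exact: Fstar_cdf_mid.
- move=> s [sa|bs]; first by rewrite Fstar_cdf_low ?mulr0// ltW.
  by rewrite /window (ltNge s) bs andbF mul0r.
- move=> s as_ _; have s0 := lt_le_trans a_gt0 as_.
  apply: cvgB; first exact: cvg_cst.
  apply: cvgM; first exact: cvg_cst.
  by apply: cvgV; [rewrite gt_eqF|exact: cvg_id].
- by move=> s as_ _; apply: is_derive_subMln; exact: lt_le_trans as_.
Qed.

(** On [[a, b[] the factor [(s - a) / s] of [F*] cancels the denominator of [Q*], leaving
    [C (ln s - ln a)], which has an elementary antiderivative. *)
Lemma Fstar_Qstar_area v : 0 <= v -> v <= b ->
  b * \int[U]_s (window 0 v s * Fc s * Qc s) =
  if v <= a then 0 else C * (v * (ln v - ln a) - v + a).
Proof.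
move=> v0 vb; case: (leP v a) => [va|av].
  rewrite (_ : (fun s => _) = (fun=> 0)) ?prob_Rintegral_cst ?mulr0//.
  apply/funext => s; rewrite /window; have [sv|_] := ltP s v.
    by rewrite Fstar_cdf_low ?mulr0 ?mul0r// (le_trans (ltW sv)).
  by rewrite andbF !mul0r.
have bh : bounded_mfun (fun s : borel R => window 0 v s * Fc s * Qc s).
  by apply: bounded_mfunM => //; exact: bounded_mfun_Qstar_cdf.
transitivity (C * (v * (ln v - ln a) - v) - C * (a * (ln a - ln a) - a)); last by ring.
apply: (@uniform_FTC _ _ b_gt0 _ (fun s => C * (ln s - ln a))
  (fun s => C * (s * (ln s - ln a) - s)) a v (ltW a_gt0) av vb (proj1 bh)).
- by move=> s; rewrite mulr_ge0 ?Qstar_cdf_ge0// mulr_ge0// Fstar_cdf_ge0.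
- move=> s as_ sv; rewrite /window (le_trans (ltW a_gt0) as_) sv mul1r.
  have s0 := lt_le_trans a_gt0 as_; have sb : s < b by exact: lt_le_trans vb.
  rewrite Fstar_cdf_mid//; have := Qstar_cdf_mul a_gt0 ab as_ (ltW sb) => h.
  have -> : 1 - a / s = (s - a) / s by field; rewrite gt_eqF.
  by rewrite mulrAC h; field; rewrite gt_eqF.
- move=> s [sa|vs]; first by rewrite Fstar_cdf_low ?mulr0 ?mul0r// ltW.
  by rewrite /window (ltNge s) vs andbF !mul0r.
- move=> s as_ _; have s0 := lt_le_trans a_gt0 as_.
  apply: cvgM; first exact: cvg_cst.
  by apply: cvgB; [exact: continuous_ln|exact: cvg_cst].
- by move=> s as_ _; apply: is_derive_xlnx; exact: lt_le_trans as_.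
Qed.

(* [Q] charges neither [b] nor the interval between its atom [0] and [a]. *)
Let supp : set (borel R) :=
  `[0, b]%classic `&` `]-oo, b[%classic `&` ~` `]0, a]%classic.

Let measurable_supp : measurable supp.
Proof.
by apply: measurableI; [exact: measurableI|exact: measurableC].
Qed.

Let Q_supp : Q supp = 1%E.
Proof.
apply: probI1; [exact: measurableI|exact: measurableC| |].
  apply: probI1 => //.
    apply: (has_cdf_prob_itvcc hQ); last exact: ltW.
    - by move=> x; exact: Qstar_cdf_neg.
    - exact: Qstar_cdf_high.
  apply/eqP; rewrite prob_lt_fineK eqe -Rintegral_lt (Qstar_prob_lt a_gt0 ab hQ)//.
  by rewrite Qstar_cdf_high.
have E : `]0, a]%classic = `]-oo, a]%classic `\` `]-oo, 0]%classic :> set (borel R).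
  apply/seteqP; split=> x; rewrite /= !in_itv/=.
    by move=> /andP[x0 xa]; split=> //; apply/negP; rewrite -ltNge.
  by move=> [xa /negP]; rewrite -ltNge => ->.
rewrite /= probability_setC// E measureD//=; last first.
  by rewrite (has_cdf_prob_le hQ) ltry.
rewrite setIidr; last first.
  by move=> x; rewrite /= !in_itv/= => /le_trans; apply; exact: ltW.
rewrite !(has_cdf_prob_le hQ) !Qstar_cdf_low// ?lexx ?(ltW a_gt0)//.
by rewrite subee// sube0.
Qed.

Let bounded_sale_pay v : 0 <= v -> v <= b ->
  bounded_mfun (fun z : borel R * borel R => sale_pay z.1 v (clip b z.2)).
Proof.
move=> v0 vb; have mc : measurable_fun [set: borel R * borel R] (fun z => clip b z.2).
  apply: measurableT_comp (proj1 (bounded_mfun_clip b_gt0)) _.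
  exact: measurable_snd.
split.
  apply: measurable_fun_ifT => //.
    apply: measurable_fun_ltr; first exact: measurable_fst.
    exact: (@measurable_maxr _ _ _ _ (fun=> v)).
  apply: measurable_maxr; first exact: measurable_fst.
  exact: (@measurable_minr _ _ _ _ (fun=> v)).
exists b => -[r w]; rewrite /sale_pay/=; case: ifP => [rm|_]; last first.
  by rewrite normr0 ltW.
have c0 := clip_ge0 b_gt0 w; have cb := clip_le b w.
have mb : Num.max v (clip b w) <= b by rewrite ge_max vb.
have m0 : 0 <= Num.min v (clip b w) by rewrite le_min v0.
rewrite ger0_norm; last by rewrite le_max m0 orbT.
by rewrite ge_max (le_trans (ltW rm) mb)/= ge_min vb.
Qed.

(** Reserves that [v] does not beat and that earn [a] from the other bidder. For [v < a] the
    threshold is [a < r], because on [supp] a positive reserve exceeds [a] and the reserve [0]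
    contributes nothing. *)
Let tail (v r : R) : bool := if v < a then a < r else v <= r.

Let tailE v : 0 <= v -> \int[Q]_r (tail v r)%:R = 1 - Qc (Num.max v a).
Proof.
move=> v0; rewrite /tail; case: (ltP v a) => [va|av].
  exact: (has_cdf_Rintegral_gt hQ).
have v_gt0 : 0 < v by exact: lt_le_trans av.
rewrite -(Qstar_prob_lt a_gt0 ab hQ v_gt0).
rewrite (_ : (fun r => _) = (fun r => 1 - (r < v)%R%:R)).
  rewrite bRintegralB ?prob_Rintegral_cst//; first exact: bounded_mfun_cst.
  exact: bounded_mfun_lt.
by apply/funext => r; case: ltP; rewrite ?subrr ?subr0.
Qed.

Let bounded_tail v : bounded_mfun (fun r : borel R => (tail v r)%:R : R).
Proof.
by rewrite /tail; case: (v < a); [exact: bounded_mfun_lt|exact: bounded_mfun_le].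
Qed.

(** If [r < v] the item is always sold, at the price [w] projected to [[r, v]], and the layer-cake
    formula applies. Otherwise only [w] can beat the reserve, which acts as a posted price: [r]
    times the probability [a / r] is [a], except for [r = 0]. *)
Let reserve_revenue v r : 0 <= v -> v <= b -> supp r ->
  \int[F]_w sale_pay r v (clip b w) =
  v * (r < v)%R%:R - b * \int[U]_s (window 0 v s * Fc s * (r <= s)%R%:R) +
  a * (tail v r)%:R.
Proof.
rewrite /supp/= !in_itv/= => v0 vb [[/andP[r0 _] rb] /negP].
rewrite negb_and -leNgt -ltNge => r0a.
have bc := bounded_mfun_clip b_gt0.
have EW s : window 0 v s * Fc s * (r <= s)%R%:R = window r v s * 1 * Fc s.
  by rewrite mulrAC windowM (max_idPr r0) mulr1.
under [in RHS]eq_Rintegral do rewrite EW.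
have bs : bounded_mfun (fun w : borel R => sale_pay r v (clip b w)).
  apply: (bounded_mfun_comp (h := fun w : borel R => (r, w)) _ (bounded_sale_pay v0 vb)).
  exact: measurable_fun_pair.
have bw1 := bounded_mfun_window_cdf b_gt0 F (bounded_window1 r v).
have [rv|vr] := ltP r v.
  have -> : tail v r = false.
    rewrite /tail; case: (ltP v a) => [va|av]; last by rewrite leNgt rv.
    by apply/negbTE; rewrite -leNgt (le_trans (ltW rv))// ltW.
  rewrite mulr0 addr0 mulr1.
  rewrite (@eq_Rintegral_prob1 _ _ _ F `[0, b]%classic _
    (fun w => v - b * \int[U]_s (window r v s * 1 * (w <= s)%R%:R)))//.
  - rewrite bRintegralB; last 2 first.
    + exact: bounded_mfun_cst.
    + by apply: bounded_mfunM => //; exact: bounded_mfun_cst.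
    by rewrite prob_Rintegral_cst bRintegralZ// (Rintegral_window_cdf b_gt0 hF).
  - exact: Fstar_support.
  - exact: (proj1 bs).
  - apply: (proj1 (bounded_mfunB (bounded_mfun_cst _ v)
      (bounded_mfunM (bounded_mfun_cst _ b) bw1))).
  - move=> w; rewrite /= in_itv/= => /andP[w0 wb]; rewrite clip_id//.
    under eq_Rintegral do rewrite mulr1.
    rewrite -(min_max_window b_gt0 w r0 (ltW rv) vb) /sale_pay.
    by rewrite lt_max rv/= max_minr (max_idPr (ltW rv)).
rewrite mulr0 sub0r (_ : (fun s => window r v s * _ * _) = (fun=> 0)); last first.
  apply/funext => s; rewrite /window; case: (leP r s) => //= rs; rewrite ?mul0r//.
  by rewrite ltNge (le_trans vr rs) !mul0r.
rewrite prob_Rintegral_cst mulr0 oppr0 add0r.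
rewrite (@eq_Rintegral_prob1 _ _ _ F `[0, b]%classic _ (fun w => r * (r < w)%R%:R))//.
- rewrite bRintegralZ ?(has_cdf_Rintegral_gt hF); last exact: bounded_mfun_lt.
  rewrite /tail; case: (ltP v a) => [va|av].
    case/orP: r0a => [rle0|ar].
      by rewrite (_ : r = 0) ?mul0r ?(ltNge a) ?(ltW a_gt0) ?mulr0//; apply/le_anti/andP.
    rewrite ar mulr1 Fstar_cdf_mid// ?(ltW ar)//.
    by field; rewrite gt_eqF// (lt_trans a_gt0).
  rewrite vr mulr1 Fstar_cdf_mid// ?(le_trans av)//.
  by field; rewrite gt_eqF// (lt_le_trans a_gt0)// (le_trans av).
- exact: Fstar_support.
- exact: (proj1 bs).
- exact: (proj1 (bounded_mfunM (bounded_mfun_cst _ r) (bounded_mfun_lt _ _))).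
- move=> w; rewrite /= in_itv/= => /andP[w0 wb]; rewrite clip_id// /sale_pay.
  rewrite lt_max (ltNge r v) vr/=; case: ltP => rw; rewrite ?mulr0// mulr1.
  by apply/max_idPl; rewrite ge_min vr.
Qed.

(** After the bid [w] and the reserve are exchanged, [reserve_revenue] is averaged over [Q]. For
    [v > a] this gives [v Q* v - C (v (ln v - ln a) - v + a) + a (1 - Q* v)], and [Qstar_cdf_mul]
    removes [Q* v] together with the logarithms. *)
Lemma first_order_condition v : 0 <= v -> v <= b ->
  \int[F]_w sale_kernel a b_gt0 v w = a + C * (v - a).
Proof.
move=> v0 vb; have bsp := bounded_sale_pay v0 vb.
have bsp' : bounded_mfun (fun z : borel R * borel R => sale_pay z.2 v (clip b z.1)).
  apply: (bounded_mfun_comp (h := fun z : borel R * borel R => (z.2, z.1)) _ bsp).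
  exact: measurable_fun_pair.
have bk := bounded_mfun_sale_kernel a_gt0 ab b_gt0.
have -> : \int[F]_w sale_kernel a b_gt0 v w = \int[F]_w \int[Q]_r sale_pay r v (clip b w).
  apply: (@eq_Rintegral_prob1 _ _ _ F `[0, b]%classic) => //.
  - exact: Fstar_support.
  - have := bounded_mfun_comp (h := fun w : borel R => (v, w)) _ bk.
    by move=> h; apply: (proj1 (h _)); exact: measurable_fun_pair.
  - exact: (proj1 (bounded_mfun_Rintegral Q bsp')).
  - move=> w; rewrite /= in_itv/= => /andP[w0 wb].
    by rewrite clip_id// (expected_sale_pay_kernel a_gt0 ab b_gt0 hQ).
rewrite (@bounded_Fubini _ _ _ _ _ F Q (fun z => sale_pay z.2 v (clip b z.1)))//=.
have bW := bounded_mfun_window_cdf b_gt0 Q (bounded_windowF 0 v).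
have blt : bounded_mfun (fun r : borel R => v * (r < v)%R%:R).
  by apply: bounded_mfunM; [exact: bounded_mfun_cst|exact: bounded_mfun_lt].
have bbW := bounded_mfunM (bounded_mfun_cst _ b) bW.
have bat := bounded_mfunM (bounded_mfun_cst _ a) (bounded_tail v).
rewrite (@eq_Rintegral_prob1 _ _ _ Q supp _ (fun r =>
  v * (r < v)%R%:R - b * \int[U]_s (window 0 v s * Fc s * (r <= s)%R%:R) +
  a * (tail v r)%:R))//; last 3 first.
- exact: (proj1 (bounded_mfun_Rintegral F bsp)).
- exact: (proj1 (bounded_mfunD (bounded_mfunB blt bbW) bat)).
- by move=> r; exact: reserve_revenue.
rewrite bRintegralD//; last exact: bounded_mfunB.
rewrite bRintegralB// !bRintegralZ//; last exact: bounded_mfun_lt.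
rewrite (Rintegral_window_cdf b_gt0 hQ)// tailE// Fstar_Qstar_area//.
rewrite (Qstar_prob_lt_mul a_gt0 ab hQ v0).
case: (leP v a) => va.
  by rewrite !Qstar_cdf_low// ?(ltW a_gt0)//; ring.
have := Qstar_cdf_mul a_gt0 ab (ltW va) vb; lra.
Qed.

End first_order.

(** * Truthfulness of the second-price auction *)

Section second_price_auction.
Variables (R : realType) (tie : R * R -> R).
Hypothesis tieP : tie_rule tie.

Lemma tie_share_itv i r c : 0 <= tie_share tie i r c <= 1.
Proof.
have /andP[t0 t1] := proj2 tieP (r, c).
by rewrite /tie_share; case: ifP => _; rewrite ?t0// subr_ge0 t1 gerBl.
Qed.

Lemma spa_alloc_itv r i b : 0 <= spa_alloc tie r i b <= 1.
Proof.
rewrite /spa_alloc; case: ifP => _; last by rewrite lexx ler01.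
case: ifP => _; first by rewrite ler01 lexx.
by case: ifP => _; [exact: tie_share_itv|rewrite lexx ler01].
Qed.

Lemma sum_spa_alloc_le1 r b : \sum_(i < 2) spa_alloc tie r i b <= 1.
Proof.
rewrite big_ord_recl big_ord1 /spa_alloc /own_bid /other_bid /tie_share /=.
case: ifP => _; last by rewrite addr0.
by case: ltgtP => [_|_|->]; rewrite ?addr0 ?add0r ?subrKC ?lexx.
Qed.

Lemma own_bid_profile i (v c : R) : own_bid i (profile i v c) = v.
Proof. by rewrite /own_bid /profile; case: (i == ord0). Qed.

Lemma other_bid_profile i (v c : R) : other_bid i (profile i v c) = c.
Proof. by rewrite /other_bid /profile; case: (i == ord0). Qed.

Lemma max_profile i (v c : R) :
  Num.max (profile i v c).1 (profile i v c).2 = Num.max v c.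
Proof. by rewrite /profile; case: (i == ord0); rewrite //= maxC. Qed.

(** A truthful bidder wins for sure when [v] exceeds the price [max r c] and never when [v] is below
    it; when they are equal, whatever the tie rule allocates is multiplied by [0]. *)
Lemma spa_truthful_surplus r i (v c : R) :
  (v - Num.max r c) * spa_alloc tie r i (profile i v c) =
  Num.max 0 (v - Num.max r c).
Proof.
rewrite /spa_alloc own_bid_profile other_bid_profile max_profile.
have [mv|vm] := ltP (Num.max r c) v.
  move: (mv); rewrite gt_max => /andP[rv cv].
  by rewrite lt_max rv cv/= mulr1; apply/esym/max_idPr; rewrite subr_ge0 ltW.
have -> : Num.max 0 (v - Num.max r c) = 0 by apply/max_idPl; rewrite subr_le0.
case: ifP => [|_]; last by rewrite mulr0.
rewrite lt_max => rvc; case: ltgtP => [cv|_|vc]; last first.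
- have rc : r < c by move: rvc; rewrite vc orbb.
  by rewrite (max_idPr (ltW rc)) vc subrr mul0r.
- by rewrite mulr0.
- have rv : r < v by case/orP: rvc => // /lt_trans; apply.
  by move: vm; rewrite leNgt gt_max rv cv.
Qed.

(** The price [max r c] does not depend on the own bid. A truthful bid earns the positive part of
    the margin, and no allocation in [[0, 1]] extracts more. *)
Lemma spa_incentive r i (v b' c : R) :
  (v - Num.max r c) * spa_alloc tie r i (profile i b' c) <=
  (v - Num.max r c) * spa_alloc tie r i (profile i v c).
Proof.
rewrite spa_truthful_surplus; have /andP[] := spa_alloc_itv r i (profile i b' c).
set x := spa_alloc _ _ _ _ => x0 x1; rewrite le_max.
have [h|h] := leP 0 (v - Num.max r c); last by rewrite nmulr_rle0 ?x0.
by rewrite ler_piMr// orbT.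
Qed.

Let measurable_own i : measurable_fun [set: borel R * borel R] (own_bid i : R * R -> R).
Proof.
by rewrite /own_bid; case: (i == ord0); [exact: measurable_fst|exact: measurable_snd].
Qed.

Let measurable_other i : measurable_fun [set: borel R * borel R] (other_bid i : R * R -> R).
Proof.
by rewrite /other_bid; case: (i == ord0); [exact: measurable_snd|exact: measurable_fst].
Qed.

Lemma measurable_spa_alloc i : measurable_fun [set: (borel R * borel R) * borel R]
  (fun z => spa_alloc tie z.2 i z.1).
Proof.
have m1 : measurable_fun [set: (borel R * borel R) * borel R] (fun z => own_bid i z.1).
  by apply: measurableT_comp (measurable_own i) _; exact: measurable_fst.
have m2 : measurable_fun [set: (borel R * borel R) * borel R] (fun z => other_bid i z.1).
  by apply: measurableT_comp (measurable_other i) _; exact: measurable_fst.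
apply: measurable_fun_ifT => //.
  apply: measurable_fun_ltr; first exact: measurable_snd.
  apply: measurable_maxr.
    by apply: measurableT_comp => //.
  by apply: measurableT_comp => //.
apply: measurable_fun_ifT => //; first exact: measurable_fun_ltr.
apply: measurable_fun_ifT => //; first exact: measurable_fun_eqr.
have mt : measurable_fun [set: (borel R * borel R) * borel R]
    (fun z => tie (z.2, own_bid i z.1)).
  by apply: measurableT_comp (proj1 tieP) _; exact: measurable_fun_pair.
rewrite /tie_share; case: (i == ord0) => //.
exact: (@measurable_funB _ _ _ _ (fun=> 1)).
Qed.

Lemma measurable_spa_pay i : measurable_fun [set: (borel R * borel R) * borel R]
  (fun z => spa_pay tie z.2 i z.1).
Proof.
apply: measurable_funM; last exact: measurable_spa_alloc.
apply: measurable_maxr; first exact: measurable_snd.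
by apply: measurableT_comp (measurable_other i) _; exact: measurable_fst.
Qed.

Lemma bounded_mfun_spa_alloc i b :
  bounded_mfun (fun r : borel R => spa_alloc tie r i b).
Proof.
split.
  apply: (measurableT_comp (f := fun z : (borel R * borel R) * borel R =>
    spa_alloc tie z.2 i z.1) (measurable_spa_alloc i) (g := fun r : borel R => (b, r))).
  exact: measurable_fun_pair.
by exists 1 => r; have /andP[x0 x1] := spa_alloc_itv r i b; rewrite ger0_norm.
Qed.

(** A payment occurs only when [r] is below the higher bid, and the price is at least the other bid,
    so the bids alone bound it on both sides. *)
Lemma bounded_mfun_spa_pay i b :
  bounded_mfun (fun r : borel R => spa_pay tie r i b).
Proof.
split.
  apply: (measurableT_comp (f := fun z : (borel R * borel R) * borel R =>
    spa_pay tie z.2 i z.1) (measurable_spa_pay i) (g := fun r : borel R => (b, r))).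
  exact: measurable_fun_pair.
exists (`|b.1| + `|b.2|) => r; rewrite /spa_pay normrM.
have [rm|mr] := ltP r (Num.max b.1 b.2); last first.
  by rewrite /spa_alloc ltNge mr normr0 mulr0 addr_ge0.
have /andP[x0 x1] := spa_alloc_itv r i b.
rewrite (ger0_norm x0); apply: (le_trans (ler_piMr _ x1)) => //.
have h1 := ler_norm b.1; have h2 := ler_norm b.2.
have h3 := ler_norm (- b.1); have h4 := ler_norm (- b.2).
rewrite !normrN in h3 h4.
have n1 := normr_ge0 b.1; have n2 := normr_ge0 b.2.
have mle : Num.max b.1 b.2 <= `|b.1| + `|b.2| by rewrite ge_max; apply/andP; split; lra.
have ole : other_bid i b <= `|b.1| + `|b.2|.
  by rewrite /other_bid; case: ifP => _; lra.
have oge : - (`|b.1| + `|b.2|) <= other_bid i b.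
  by rewrite /other_bid; case: ifP => _; lra.
rewrite ler_norml ge_max ole (le_trans (ltW rm) mle) le_max oge orbT.
by [].
Qed.

Lemma sum_Rintegral_spa_pay (Q : probability (borel R) R) (v w : R) :
  \sum_(i < 2) pay (spa_random_reserve Q tie) i (v, w) =
  \int[Q]_r sale_pay r v w.
Proof.
rewrite big_ord_recl big_ord1 /= -bRintegralD; try exact: bounded_mfun_spa_pay.
by apply: eq_Rintegral => r _; rewrite -(sum_spa_pay tie) big_ord_recl big_ord1.
Qed.

Lemma spa_random_reserve_truthful (Q : probability (borel R) R) :
  truthful (spa_random_reserve Q tie).
Proof.
have util i v b c : utility (spa_random_reserve Q tie) i v (profile i b c) =
    \int[Q]_r ((v - Num.max r c) * spa_alloc tie r i (profile i b c)).
  have ba := bounded_mfun_spa_alloc i (profile i b c).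
  have bp := bounded_mfun_spa_pay i (profile i b c).
  rewrite /utility /= -bRintegralZ// -bRintegralB//; last first.
    by apply: bounded_mfunM => //; exact: bounded_mfun_cst.
  by apply: eq_Rintegral => r _; rewrite /spa_pay other_bid_profile mulrBl.
have butil i v b c : bounded_mfun (fun r : borel R =>
    (v - Num.max r c) * spa_alloc tie r i (profile i b c)).
  rewrite (_ : (fun r => _) = (fun r : borel R =>
    v * spa_alloc tie r i (profile i b c) - spa_pay tie r i (profile i b c))).
    apply: bounded_mfunB; last exact: bounded_mfun_spa_pay.
    apply: (@bounded_mfunM _ _ _ (fun=> v)); first exact: bounded_mfun_cst.
    exact: bounded_mfun_spa_alloc.
  by apply/funext => r; rewrite /spa_pay other_bid_profile mulrBl.
split.
- by move=> i; exact: (measurable_Rintegral Q (measurable_spa_alloc i)).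
- by move=> i; exact: (measurable_Rintegral Q (measurable_spa_pay i)).
- move=> i b _ _ /=; apply/andP; split.
    by apply: Rintegral_ge0 => r _; have /andP[] := spa_alloc_itv r i b.
  rewrite -[leRHS](prob_Rintegral_cst Q).
  apply: le_bRintegral; [exact: bounded_mfun_spa_alloc|exact: bounded_mfun_cst|].
  by move=> r; have /andP[] := spa_alloc_itv r i b.
- move=> b _ _; rewrite big_ord_recl big_ord1 /= -bRintegralD; try exact: bounded_mfun_spa_alloc.
  rewrite -[leRHS](prob_Rintegral_cst Q); apply: le_bRintegral.
  + by apply: bounded_mfunD; exact: bounded_mfun_spa_alloc.
  + exact: bounded_mfun_cst.
  + by move=> r; have := sum_spa_alloc_le1 r b; rewrite big_ord_recl big_ord1.
- move=> i v b' c _ _ _; rewrite !util; apply: le_bRintegral => // r.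
  exact: spa_incentive.
- move=> i v c _ _; rewrite util; apply: Rintegral_ge0 => r _.
  by rewrite spa_truthful_surplus le_max lexx.
Qed.

End second_price_auction.

(** On [[0, b]^2], a set of full product measure, the total payment equals the bounded kernel, so
    the extended-real expectation becomes an iterated real integral. *)
Lemma Rev_spa_random_reserve (R : realType) (a b : R) (a_gt0 : 0 < a)
    (ab : a < b) (b_gt0 : 0 < b) (P Q : probability (borel R) R)
    (tie : R * R -> R) :
  has_cdf Q (Qstar_cdf a b) -> tie_rule tie -> P `[0, b]%classic = 1%E ->
  Rev P (spa_random_reserve Q tie) = (cross_revenue a b_gt0 P P)%:E.
Proof.
move=> hQ tieP P1; have bk := bounded_mfun_sale_kernel a_gt0 ab b_gt0.
rewrite /Rev unlock -(bounded_Rintegral_prod P P bk).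
have T := spa_random_reserve_truthful tieP Q.
pose A : set (borel R) := `[0, b]%classic.
have mA : measurable A by exact: measurable_itv.
apply: (@eq_integral_prob1 _ _ _ (P \x P)%E (A `*` A)).
- exact: measurableX.
- by rewrite [LHS]product_measure1E//= P1 mule1.
- apply/measurable_EFinP; apply: measurable_sum => i.
  exact: (measurable_pay T).
- by apply/measurable_EFinP; apply: (proj1 bk).
- move=> [v w] [/=]; rewrite /A/= !in_itv/= => /andP[v0 vb] /andP[w0 wb].
  by rewrite (sum_Rintegral_spa_pay tieP) (expected_sale_pay_kernel a_gt0 ab b_gt0 hQ).
Qed.

(** * Upper bound for truthful mechanisms *)

(* The payment rule is bounded by a mixture of posted prices [u k.+1], each paid
   exactly when the value exceeds [u k]. *)
Lemma posted_price_bound (R : realType) (x p : R -> R) (u : nat -> R) (m : nat)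
    (v : R) :
  0 <= u 0%N -> (forall k, u k <= u k.+1) ->
  (forall s t, 0 <= s -> s <= t -> x s <= x t) ->
  (forall s t, 0 <= s -> s <= t -> p s <= p t) ->
  (forall s t, 0 <= s -> s <= t -> p t - p s <= t * (x t - x s)) ->
  p (u 0%N) <= u 0%N * x (u 0%N) ->
  u 0%N <= v -> v <= u m ->
  p v <= u 0%N * x (u 0%N) +
    \sum_(k < m) (u k < v)%R%:R * (u k.+1 * (x (u k.+1) - x (u k))).
Proof.
move=> u0 uS xm pm pS p0.
have uge k : u 0%N <= u k by elim: k => // k ih; exact: le_trans (uS k).
have u_ge0 k : 0 <= u k by exact: le_trans (uge k).
have T0 k : 0 <= u k.+1 * (x (u k.+1) - x (u k)).
  by rewrite mulr_ge0// subr_ge0 xm.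
elim: m v => [|m ih] v v0 vm.
  by rewrite big_ord0 addr0 (_ : v = u 0%N)//; apply/le_anti; rewrite vm v0.
rewrite big_ord_recr /= addrA; have [vum|umv] := leP v (u m).
  by rewrite mul0r addr0; exact: ih.
rewrite mul1r.
have h1 : p v <= p (u m.+1) by apply: pm => //; exact: le_trans v0.
have h2 := pS _ _ (u_ge0 m) (uS m).
have h3 := ih (u m) (uge m) (lexx _).
have h4 : \sum_(k < m) (u k < u m)%R%:R * (u k.+1 * (x (u k.+1) - x (u k))) <=
    \sum_(k < m) (u k < v)%R%:R * (u k.+1 * (x (u k.+1) - x (u k))).
  apply: ler_sum => k _; apply: ler_wpM2r => //.
  by case: (ltP (u k) (u m)) => // kum; rewrite (lt_trans kum umv).
lra.
Qed.

Section truthful_theory.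
Variables (R : realType) (M : mechanism R).
Hypothesis truthfulM : truthful M.

Let x i own other := alloc M i (profile i own other).
Let p i own other := pay M i (profile i own other).

Let profile_ge0 i (v c : R) : 0 <= v -> 0 <= c ->
  0 <= (profile i v c).1 /\ 0 <= (profile i v c).2.
Proof. by rewrite /profile; case: (i == ord0). Qed.

Lemma truthful_alloc_itv i v c : 0 <= v -> 0 <= c -> 0 <= x i v c <= 1.
Proof.
move=> v0 c0; have [h1 h2] := profile_ge0 i v0 c0.
exact: (alloc_itv truthfulM).
Qed.

Lemma truthful_ic i v b' c : 0 <= v -> 0 <= b' -> 0 <= c ->
  v * x i b' c - p i b' c <= v * x i v c - p i v c.
Proof. exact: (incentive_compatible truthfulM). Qed.

Lemma truthful_alloc_monotone i c s t : 0 <= c -> 0 <= s -> s <= t ->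
  x i s c <= x i t c.
Proof.
move=> c0 s0; rewrite le_eqVlt => /predU1P[->//|st].
have t0 : 0 <= t by rewrite (le_trans s0)// ltW.
have h1 := truthful_ic i s0 t0 c0; have h2 := truthful_ic i t0 s0 c0.
rewrite -(@ler_pM2l _ (t - s)) ?subr_gt0//; lra.
Qed.

Lemma truthful_pay_monotone i c s t : 0 <= c -> 0 <= s -> s <= t ->
  p i s c <= p i t c.
Proof.
move=> c0 s0 st; have t0 : 0 <= t by rewrite (le_trans s0).
have h1 := truthful_ic i s0 t0 c0.
have h2 : s * x i s c <= s * x i t c by rewrite ler_wpM2l// truthful_alloc_monotone.
lra.
Qed.

Lemma truthful_pay_increment i c s t : 0 <= c -> 0 <= s -> s <= t ->
  p i t c - p i s c <= t * (x i t c - x i s c).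
Proof.
move=> c0 s0 st; have t0 : 0 <= t by rewrite (le_trans s0).
have := truthful_ic i t0 s0 c0; lra.
Qed.

Lemma truthful_ir i v c : 0 <= v -> 0 <= c -> p i v c <= v * x i v c.
Proof.
move=> v0 c0; have := individually_rational truthfulM i v0 c0.
by rewrite /utility subr_ge0.
Qed.

End truthful_theory.

Section revenue_upper_bound.
Variables (R : realType) (a b : R).
Hypotheses (a_gt0 : 0 < a) (ab : a < b).
Variables (F : probability (borel R) R) (M : mechanism R).
Hypotheses (hF : has_cdf F (Fstar_cdf a b)) (truthfulM : truthful M).

Let b_gt0 : 0 < b. Proof. exact: lt_trans ab. Qed.

Let x i own other := alloc M i (profile i own other).
Let p i own other := pay M i (profile i own other).

Variable n : nat.
(** Prices are discretised on a grid of [n + 1] cells from [a] to [b], so that a finite sum replaces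
    a Stieltjes integral against the allocation; the error vanishes with the mesh [d]. *)
Let d : R := (b - a) / n.+1%:R.
Let u (k : nat) : R := a + k%:R * d.

Let d_ge0 : 0 <= d.
Proof. by rewrite divr_ge0// subr_ge0 ltW. Qed.

Let u0 : u 0%N = a. Proof. by rewrite /u mul0r addr0. Qed.

Let uS k : u k.+1 = u k + d.
Proof. by rewrite /u -natr1 mulrDl mul1r addrA. Qed.

Let un : u n.+1 = b.
Proof. by rewrite /u mulrC divfK ?pnatr_eq0// subrKC. Qed.

Let u_ge k : a <= u k.
Proof. by rewrite /u lerDl mulr_ge0. Qed.

Let u_gt0 k : 0 < u k. Proof. exact: lt_le_trans (u_ge k). Qed.

Let u_lt k : (k < n.+1)%N -> u k < b.
Proof.
move=> kn; rewrite -un /u ltrD2l ltr_pM2r ?ltr_nat//.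
by rewrite divr_gt0// subr_gt0.
Qed.

Let c_ge0 c : 0 <= clip b c. Proof. exact: clip_ge0. Qed.

Let step i k c := u k.+1 * (x i (u k.+1) (clip b c) - x i (u k) (clip b c)).

(** Upper bound for the payment of bidder [i], where [z.1] is the own bid and [z.2] the opposing
    one. The clipped opposing bid is nonnegative, so the truthfulness conditions apply to it. *)
Let S i (z : R * R) : R := a * x i a (clip b z.2) +
  \sum_(k < n.+1) (u k < z.1)%R%:R * step i k z.2.

Let bounded_x i v : 0 <= v -> bounded_mfun (fun c : borel R => x i v (clip b c)).
Proof.
move=> v0; split; last first.
  exists 1 => c; have /andP[x0 x1] := truthful_alloc_itv truthfulM i v0 (c_ge0 c).
  by rewrite ger0_norm.
have mc := proj1 (bounded_mfun_clip b_gt0).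
apply: (measurableT_comp (f := alloc M i) (measurable_alloc truthfulM i)
  (g := fun c : borel R => profile i v (clip b c))).
by rewrite /profile; case: (i == ord0); exact: measurable_fun_pair.
Qed.

Let step_ge0 i k c : 0 <= step i k c.
Proof.
apply: mulr_ge0; first exact/ltW/u_gt0.
rewrite subr_ge0; apply: (truthful_alloc_monotone truthfulM) => //.
  exact/ltW/u_gt0.
by rewrite uS lerDl.
Qed.

Let bounded_step i k : bounded_mfun (fun c : borel R => step i k c).
Proof.
apply: (@bounded_mfunM _ _ _ (fun=> u k.+1)); first exact: bounded_mfun_cst.
by apply: bounded_mfunB; apply: bounded_x; exact/ltW/u_gt0.
Qed.

Let S_ge0 i z : 0 <= S i z.
Proof.
apply: addr_ge0.
  apply: mulr_ge0; first exact: ltW.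
  by have /andP[] := truthful_alloc_itv truthfulM i (ltW a_gt0) (c_ge0 z.2).
by apply: sumr_ge0 => k _; apply: mulr_ge0.
Qed.

Let bounded_mfun_sum d' (T : measurableType d') m (f : nat -> T -> R) :
  (forall k, bounded_mfun (f k)) -> bounded_mfun (fun z => \sum_(k < m) f k z).
Proof.
move=> bf; elim: m => [|m ih].
  rewrite (_ : (fun z => _) = (fun=> 0)); first exact: bounded_mfun_cst.
  by apply/funext => z; rewrite big_ord0.
rewrite (_ : (fun z => _) = (fun z => \sum_(k < m) f k z + f m z)).
  exact: bounded_mfunD.
by apply/funext => z; rewrite big_ord_recr.
Qed.

Let bounded_S i : bounded_mfun (S i : borel R * borel R -> R).
Proof.
apply: bounded_mfunD.
  apply: (@bounded_mfunM _ _ _ (fun=> a)); first exact: bounded_mfun_cst.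
  exact: (bounded_mfun_comp measurable_snd (bounded_x i (ltW a_gt0))).
apply: (@bounded_mfun_sum _ _ n.+1 (fun k z => (u k < z.1)%R%:R * step i k z.2)) => k.
apply: bounded_mfunM; last exact: (bounded_mfun_comp measurable_snd (bounded_step i k)).
by apply: bounded_mfun_lt => //; exact: measurable_fst.
Qed.

Let pay_le i v c : a <= v -> v <= b -> 0 <= c -> c <= b -> p i v c <= S i (v, c).
Proof.
move=> av vb c0 cb; rewrite /S /step /= clip_id//.
have := @posted_price_bound R (fun s => x i s c) (fun s => p i s c) u n.+1 v.
rewrite u0; apply => //.
- exact: ltW.
- by move=> k; rewrite uS lerDl.
- by move=> s t; exact: (truthful_alloc_monotone truthfulM).
- by move=> s t; exact: (truthful_pay_monotone truthfulM).
- by move=> s t; exact: (truthful_pay_increment truthfulM).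
- by apply: (truthful_ir truthfulM) => //; exact: ltW.
- by rewrite un.
Qed.

Let bounded_lt t : bounded_mfun (fun v : borel R => (t < v)%R%:R : R).
Proof. exact: bounded_mfun_lt. Qed.

Let Rintegral_sum m (f : nat -> borel R -> R) : (forall k, bounded_mfun (f k)) ->
  \int[F]_v (\sum_(k < m) f k v) = \sum_(k < m) \int[F]_v f k v.
Proof.
move=> bf; elim: m => [|m ih].
  rewrite big_ord0 -[RHS](prob_Rintegral_cst F); apply: eq_Rintegral => v _.
  by rewrite big_ord0.
rewrite big_ord_recr /= -ih -bRintegralD//; last exact: bounded_mfun_sum.
by apply: eq_Rintegral => v _; rewrite big_ord_recr.
Qed.

(* [a / u k] is the probability of a value above [u k], so every posted price
   yields at most [(a / u k) * u k.+1 <= a + d]. *)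
Let Rintegral_S i c : \int[F]_v S i (v, c) <= (a + d) * x i b (clip b c).
Proof.
have bk k : bounded_mfun (fun v : borel R => (u k < v)%R%:R * step i k c).
  by apply: bounded_mfunM => //; exact: bounded_mfun_cst.
rewrite /S bRintegralD/=; [|exact: bounded_mfun_cst|]; last first.
  exact: (bounded_mfun_sum n.+1 bk).
rewrite prob_Rintegral_cst (Rintegral_sum n.+1 bk).
have /andP[xa0 _] := truthful_alloc_itv truthfulM i (ltW a_gt0) (c_ge0 c).
apply: (@le_trans _ _ ((a + d) * x i a (clip b c) + \sum_(k < n.+1)
    (a + d) * (x i (u k.+1) (clip b c) - x i (u k) (clip b c)))).
  apply: lerD; first by rewrite ler_wpM2r// lerDl.
  apply: ler_sum => k _; under eq_Rintegral do rewrite mulrC.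
  rewrite bRintegralZ// (has_cdf_Rintegral_gt hF) Fstar_cdf_mid//; last exact: u_lt.
  rewrite subKr /step mulrAC; apply: ler_wpM2r.
    rewrite subr_ge0; apply: (truthful_alloc_monotone truthfulM) => //.
      exact/ltW/u_gt0.
    by rewrite uS lerDl.
  rewrite mulrA ler_pdivrMr// uS.
  have h := ler_wpM2l d_ge0 (u_ge k); lra.
rewrite -mulr_sumr -mulrDr.
rewrite -(big_mkord xpredT (fun k => x i (u k.+1) _ - x i (u k) _)) /=.
by rewrite telescope_sumr// u0 un subrKC.
Qed.

Let bounded_pair : bounded_mfun (fun z : borel R * borel R => S ord0 z + S ord_max (z.2, z.1)).
Proof.
apply: bounded_mfunD; first exact: bounded_S.
apply: (bounded_mfun_comp (h := fun z : borel R * borel R => (z.2, z.1)) _ (bounded_S ord_max)).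
exact: measurable_fun_pair.
Qed.

(** For [c >= b] both terms belong to the single profile [(b, b)], where feasibility limits their
    sum to [1]; for smaller [c] they belong to two different profiles and each is bounded by [1]
    separately. *)
Let sum_alloc_le c : x ord0 b (clip b c) + x ord_max b (clip b c) <= 1 + (c < b)%R%:R.
Proof.
have [cb|bc] := ltP c b.
  have /andP[_ h1] := truthful_alloc_itv truthfulM ord0 (ltW b_gt0) (c_ge0 c).
  have /andP[_ h2] := truthful_alloc_itv truthfulM ord_max (ltW b_gt0) (c_ge0 c).
  exact: lerD.
have -> : clip b c = b.
  by apply/min_idPl; rewrite le_max bc orbT.
have := alloc_sum truthfulM (b := (b, b)) (ltW b_gt0) (ltW b_gt0).
rewrite big_ord_recl big_ord1 addr0 /x /profile /=.
by rewrite (_ : lift ord0 ord0 = ord_max)//; exact: val_inj.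
Qed.

(** Fubini lets each bidder's own value be integrated first against a common opposing bid [c], so
    that [Rintegral_S] and [sum_alloc_le] combine; the mean of [1 + (c < b)] is then at most
    [2 - a / b]. *)
Let Rintegral_pair_le :
  \int[F]_v \int[F]_w (S ord0 (v, w) + S ord_max (w, v)) <=
  (a + d) * (2 - a / b).
Proof.
have bS0 := bounded_S ord0; have bS1 := bounded_S ord_max.
have bs1 : bounded_mfun (fun z : borel R * borel R => S ord_max (z.2, z.1)).
  apply: (bounded_mfun_comp (h := fun z : borel R * borel R => (z.2, z.1)) _ bS1).
  exact: measurable_fun_pair.
have bs0 : bounded_mfun (fun z : borel R * borel R => S ord0 (z.2, z.1)).
  apply: (bounded_mfun_comp (h := fun z : borel R * borel R => (z.2, z.1)) _ bS0).
  exact: measurable_fun_pair.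
have E v : \int[F]_w (S ord0 (v, w) + S ord_max (w, v)) =
    \int[F]_w S ord0 (v, w) + \int[F]_w S ord_max (w, v).
  apply: bRintegralD.
    apply: (bounded_mfun_comp (h := fun w : borel R => (v, w)) _ bS0).
    exact: measurable_fun_pair.
  apply: (bounded_mfun_comp (h := fun w : borel R => (w, v)) _ bS1).
  exact: measurable_fun_pair.
under eq_Rintegral do rewrite E.
have bI0 := bounded_mfun_Rintegral F bs0; have bI1 := bounded_mfun_Rintegral F bs1.
rewrite bRintegralD//; last exact: (bounded_mfun_Rintegral F bS0).
rewrite (bounded_Fubini F F bS0) -bRintegralD//.
have blt : bounded_mfun (fun c : borel R => (c < b)%R%:R : R) by exact: bounded_mfun_lt.
have bcst k := bounded_mfun_cst (borel R) (k : R).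
apply: (@le_trans _ _ (\int[F]_c ((a + d) * (1 + (c < b)%R%:R)))).
  apply: le_bRintegral.
  - exact: bounded_mfunD.
  - by apply: bounded_mfunM => //; exact: bounded_mfunD.
  - move=> c; have h0 := Rintegral_S ord0 c; have h1 := Rintegral_S ord_max c.
    apply: (le_trans (lerD h0 h1)); rewrite -mulrDr ler_wpM2l//.
    by rewrite addr_ge0// ltW.
rewrite bRintegralZ; last exact: bounded_mfunD.
rewrite bRintegralD// prob_Rintegral_cst Rintegral_lt ler_wpM2l ?addr_ge0 ?(ltW a_gt0)//.
rewrite -addrA lerD2l lerBrDr.
(* [F*] stays below [1 - a / b] to the left of [b]: its atom at [b] has mass at least [a / b]. *)
have : fine (F `]-oo, b[%classic) <= 1 - a / b.
  rewrite -lee_fin -prob_lt_fineK; apply: (has_cdf_prob_lt_le hF) => y yb.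
  have [ya|ay] := leP y a.
    rewrite Fstar_cdf_low// subr_ge0 ler_pdivrMr// mul1r; exact: ltW.
  have y_gt0 := lt_trans a_gt0 ay.
  rewrite Fstar_cdf_mid// ?(ltW ay)// lerB// ler_pM2l// lef_pV2 ?posrE//.
  exact: ltW.
lra.
Qed.

Let Fstar_support_cc : F `[a, b]%classic = 1%E.
Proof.
apply: (has_cdf_prob_itvcc hF); last exact: ltW.
- by move=> y /ltW; exact: Fstar_cdf_low.
- exact: Fstar_cdf_high.
Qed.

(** Payments of a truthful mechanism may be unbounded below and fail to be integrable, so they are
    capped by the bounded [T] and the revenue is estimated through the positive part of the capped
    function. *)
Lemma Rev_grid_bound : (Rev F M <= ((a + d) * (2 - a / b))%:E)%E.
Proof.
rewrite /Rev unlock.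
pose T (z : borel R * borel R) : R := S ord0 z + S ord_max (z.2, z.1).
pose f (z : borel R * borel R) : R := \sum_(i < 2) pay M i z.
have T0 z : 0 <= T z by rewrite addr_ge0.
have mf : measurable_fun [set: borel R * borel R] f.
  by apply: measurable_sum => i; exact: (measurable_pay truthfulM).
have mT : measurable_fun [set: borel R * borel R] T := proj1 bounded_pair.
pose A : set (borel R) := `[a, b]%classic.
have mA : measurable A by exact: measurable_itv.
have mm : measurable_fun [set: borel R * borel R] (fun z => Num.min (f z) (T z)).
  exact: measurable_minr.
rewrite (@eq_integral_prob1 _ _ _ (F \x F)%E (A `*` A) _
  (fun z => (Num.min (f z) (T z))%:E)); last 5 first.
- exact: measurableX.
- by rewrite [LHS]product_measure1E//= Fstar_support_cc mule1.
- by apply/measurable_EFinP; apply: mf.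
- by apply/measurable_EFinP; apply: mm.
- move=> [v w] [/=]; rewrite /A/= !in_itv/= => /andP[av vb] /andP[aw wb].
  congr (_%:E); apply/esym/min_idPl; rewrite /f /T big_ord_recl big_ord1 /=.
  have v0 := le_trans (ltW a_gt0) av; have w0 := le_trans (ltW a_gt0) aw.
  apply: lerD; first exact: (pay_le ord0 av vb w0 wb).
  rewrite (_ : lift ord0 ord0 = ord_max); last exact: val_inj.
  exact: (pay_le ord_max aw wb v0 vb).
apply: (@le_trans _ _ (\int[F \x F]_z (T z)%:E)%E); last first.
  by rewrite (bounded_Rintegral_prod F F bounded_pair) lee_fin; exact: Rintegral_pair_le.
rewrite integralE; apply: (@le_trans _ _
  (\int[F \x F]_z (((fun z => (Num.min (f z) (T z))%:E)^\+)%E z))%E).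
  rewrite -[leRHS]sube0; apply: leeB => //; apply: integral_ge0 => z _.
  exact: funeneg_ge0.
apply: ge0_le_integral => //.
- by apply: measurable_funepos; apply/measurable_EFinP; apply: mm.
- by apply/measurable_EFinP; apply: mT.
- move=> z _; rewrite funeposE ge_max lee_fin ge_min lexx orbT/=.
  by rewrite lee_fin.
Qed.

End revenue_upper_bound.

Lemma Rev_Fstar_le (R : realType) (a b : R) (F : probability (borel R) R)
    (M : mechanism R) : 0 < a -> a < b -> has_cdf F (Fstar_cdf a b) ->
  truthful M -> (Rev F M <= (a * (2 - a / b))%:E)%E.
Proof.
move=> a0 ab hF tM; apply/lee_addgt0Pr => e e0.
have b0 := lt_trans a0 ab.
have c0 : 0 <= a / b by rewrite divr_ge0// ltW.
(* More than [k] cells make [2 d < e], and the factor [2 - a / b] is at most [2]. *)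
pose k := (b - a) * 2 / e.
have k0 : 0 <= k by rewrite divr_ge0 ?mulr_ge0// ?subr_ge0// ltW.
have [n kn] : exists n : nat, k < n.+1%:R.
  by exists (Num.truncn k); exact: truncnS_gt.
apply: (le_trans (Rev_grid_bound a0 ab hF tM n)).
rewrite -EFinD lee_fin mulrDl lerD2l.
rewrite /k ltr_pdivrMr// in kn.
apply: (@le_trans _ _ ((b - a) / n.+1%:R * 2)).
  by rewrite ler_wpM2l ?gerBl// divr_ge0// subr_ge0 ltW.
by rewrite mulrAC ler_pdivrMr// mulrC (mulrC e) ltW// mulrC.
Qed.

(** * Equilibrium *)

Lemma expectation_clip (R : realType) (b : R) (P : probability (borel R) R) :
  0 < b -> P `[0, b]%classic = 1%E ->
  ('E_P[@value_of R] = (\int[P]_v clip b v)%:E)%E.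
Proof.
move=> b0 P1; have bc := bounded_mfun_clip b0.
rewrite unlock -(Rintegral_EFin P bc).
apply: (@eq_integral_prob1 _ _ _ P `[0, b]%classic) => //.
- by apply/measurable_EFinP; exact: measurable_id.
- by apply/measurable_EFinP; exact: (proj1 bc).
- by move=> v; rewrite /= in_itv/= => /andP[v0 vb]; rewrite clip_id.
Qed.

(** By [first_order_condition] the inner integral is affine in [v], so only the mean of [P] matters;
    [C (ln b - ln a) = 1 - a / b] then evaluates the whole to [a + a (1 - a / b)]. *)
Lemma cross_revenue_Fstar (R : realType) (a b : R) (a_gt0 : 0 < a) (ab : a < b)
    (b_gt0 : 0 < b) (P F Q : probability (borel R) R) :
  has_cdf F (Fstar_cdf a b) -> has_cdf Q (Qstar_cdf a b) ->
  P `[0, b]%classic = 1%E ->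
  ('E_P[@value_of R] = (a * (1 + ln b - ln a))%:E)%E ->
  cross_revenue a b_gt0 P F = a * (2 - a / b).
Proof.
move=> hF hQ P1 mean.
have bc := bounded_mfun_clip b_gt0.
have bk := bounded_mfun_sale_kernel a_gt0 ab b_gt0.
have bsub : bounded_mfun (fun v : borel R => clip b v - a).
  by apply: bounded_mfunB => //; exact: bounded_mfun_cst.
have bC := bounded_mfun_cst (borel R) (Qstar_atom a b).
rewrite /cross_revenue (@eq_Rintegral_prob1 _ _ _ P `[0, b]%classic _
  (fun v => a + Qstar_atom a b * (clip b v - a)))//.
- rewrite bRintegralD; [|exact: bounded_mfun_cst|exact: bounded_mfunM].
  rewrite bRintegralZ// bRintegralB//; last exact: bounded_mfun_cst.
  rewrite !prob_Rintegral_cst.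
  move: mean; rewrite (expectation_clip b_gt0 P1) => -[->].
  rewrite /Qstar_atom; field.
  by rewrite subr_eq0 !gt_eqF// ltr_ln ?posrE.
- exact: (proj1 (bounded_mfun_Rintegral F bk)).
- apply: (proj1 (bounded_mfunD (bounded_mfun_cst _ a) (bounded_mfunM bC bsub))).
- move=> v; rewrite /= in_itv/= => /andP[v0 vb].
  by rewrite (first_order_condition a_gt0 ab b_gt0 hF hQ v0 vb) clip_id.
Qed.

Theorem theorem3p2 (R : realType) (mu vbar : R)
    (mu_gt0 : 0 < mu) (mu_lt_vbar : mu < vbar) :
  (exists! vlow : R, is_vlow mu vbar vlow) /\
  (forall vlow : R, is_vlow mu vbar vlow ->
    [/\ exists Fstar : probability (borel R) R,
          has_cdf Fstar (Fstar_cdf vlow vbar),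
        exists Qstar : probability (borel R) R,
          has_cdf Qstar (Qstar_cdf vlow vbar) &
        forall (Fstar Qstar : probability (borel R) R) (tie : R * R -> R),
          has_cdf Fstar (Fstar_cdf vlow vbar) ->
          has_cdf Qstar (Qstar_cdf vlow vbar) ->
          tie_rule tie ->
          let Mstar := spa_random_reserve Qstar tie in
          [/\ is_equilibrium mu vbar Mstar Fstar,
              argmax (@truthful_mechanisms R) (worst_case_rev mu vbar) Mstar &
              argmin (ambiguity_set mu vbar) (@best_rev R) Fstar]]).
Proof.
split; first exact: exists_vlow.
move=> a va; have /andP[a0 ab] := is_vlow_lt_vbar mu_lt_vbar va.
have b0 := lt_trans a0 ab; have muE := proj2 va.
split; [exact: exists_Fstar|exact: exists_Qstar|].
move=> F Q tie hF hQ tieP M.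
have tM : truthful M by exact: spa_random_reserve_truthful.
have F1 := Fstar_support a0 ab b0 hF.
have meanF : ('E_F[@value_of R] = mu%:E)%E.
  by rewrite (expectation_clip b0 F1) (Fstar_mean a0 ab b0 hF) muE.
have aF : ambiguity_set mu vbar F by split.
pose rev := a * (2 - a / vbar).
have crossF P : ambiguity_set mu vbar P -> cross_revenue a b0 P F = rev.
  by move=> [P1 Pmu]; apply: (cross_revenue_Fstar a0 ab b0 hF hQ P1); rewrite Pmu muE.
have RevM P : ambiguity_set mu vbar P -> Rev P M = (cross_revenue a b0 P P)%:E.
  by move=> [P1 _]; exact: Rev_spa_random_reserve.
have RevFM : Rev F M = rev%:E by rewrite RevM// crossF.
have upper M' : truthful M' -> (Rev F M' <= Rev F M)%E.
  by move=> tM'; rewrite RevFM; exact: Rev_Fstar_le.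
have lower P : ambiguity_set mu vbar P -> (Rev F M <= Rev P M)%E.
  move=> aP; rewrite RevFM RevM// lee_fin.
  (* The cross term and the term of [F] both equal [rev], so [2 rev <= B P P + rev]. *)
  have := cross_revenue_psd a0 ab b0 P F; rewrite !crossF//; lra.
split=> //; split=> //.
(* The saddle value separates the two sides: the worst case of [M'] is at most its revenue at [F],
   while every revenue of [M] on the ambiguity set is at least the saddle value. *)
- move=> M' tM'; apply: (@le_trans _ _ (Rev F M)).
    by apply: le_trans (upper _ tM'); apply: ereal_inf_lbound; exists F.
  by apply: le_ereal_inf_tmp => _ [P aP <-]; exact: lower.
- move=> P aP; apply: (@le_trans _ _ (Rev F M)).
    by apply: ge_ereal_sup => _ [M' tM' <-]; exact: upper.
  by apply: (le_trans (lower _ aP)); apply: ereal_sup_ubound; exists M.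
Qed.
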